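(* Construct an $M\times N$ matrix $\Phi$ by drawing each of its entries independently from a Gaussian distribution with mean zero and variance $\frac{1}{M}$, and define $$\delta_{K;q}:=\max_{\substack{\mathcal{K}\subseteq\{1,\ldots,N\}\\|\mathcal{K}|=K}}\mathrm{Tr}\big[(\Phi_\mathcal{K}^*\Phi_\mathcal{K}-\mathrm{I}_K)^{2q}\big]^{\frac{1}{2q}}.$$ Then $\delta_{K;q}\leq\delta$, and therefore $\Phi$ has the $(K,\delta)$-restricted isometry property, with high probability provided $$M\geq\frac{81}{\delta^2}\,K^{1+1/q}\log\frac{eN}{K}.$$
   Context: Here $q\geq1$ is an integer, $\log$ is the natural logarithm and $\|\cdot\|$ is the Euclidean norm. For $\mathcal{K}\subseteq\{1,\ldots,N\}$, $\Phi_\mathcal{K}$ denotes the submatrix of $\Phi$ consisting of the columns indexed by $\mathcal{K}$, and $\mathrm{I}_K$ is the $K\times K$ identity matrix. A vector is $K$-sparse if at most $K$ of its entries are nonzero. A matrix $\Phi$ has the $(K,\delta)$-restricted isometry property if $(1-\delta)\|x\|^2\leq\|\Phi x\|^2\leq(1+\delta)\|x\|^2$ for every $K$-sparse vector $x$.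
   Formalization: The formal statement restricts δ to 0 < δ < 1, the usual range of restricted isometry constants; without an upper bound on δ the claim fails (e.g. q = 1, K = 1, δ = 100). *)

(* Defs.v *)
From HB Require Import structures.
From mathcomp Require Import all_boot all_order all_algebra.
From mathcomp Require Import all_classical all_reals all_analysis.

Set Implicit Arguments.
Unset Strict Implicit.
Unset Printing Implicit Defensive.

Import Order.TTheory GRing.Theory Num.Theory.
Import numFieldNormedType.Exports.

Local Open Scope classical_set_scope.
Local Open Scope ring_scope.

(* The library norm `|x| on 'cV_n is the sup norm, not the Euclidean one. *)
Definition l2norm (R : realType) (n : nat) (x : 'cV[R]_n) : R :=
  Num.sqrt (\sum_(i < n) x i ord0 ^+ 2).

Definition sparse (R : realType) (n K : nat) (x : 'cV[R]_n) : bool :=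
  (#|[pred i : 'I_n | x i ord0 != 0%R]| <= K)%N.

Definition RIP (R : realType) (M N : nat) (Phi : 'M[R]_(M, N))
    (K : nat) (delta : R) : Prop :=
  forall x : 'cV[R]_N, sparse K x ->
    (1 - delta) * l2norm x ^+ 2 <= l2norm (Phi *m x) ^+ 2
      <= (1 + delta) * l2norm x ^+ 2.

Definition column_submatrix (R : realType) (M N : nat) (Phi : 'M[R]_(M, N))
    (S : {set 'I_N}) : 'M[R]_(M, #|S|) :=
  colsub (fun j : 'I_#|S| => enum_val j) Phi.

Definition gram_deviation (R : realType) (M N : nat) (Phi : 'M[R]_(M, N))
    (S : {set 'I_N}) : 'M[R]_#|S| :=
  (column_submatrix Phi S)^T *m column_submatrix Phi S - 1%:M.

(* Values of `^ are nonnegative, so the default 0 of the big maximum only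
   matters when there is no set of size K, i.e. when N < K. *)
Definition power_delta (R : realType) (M N : nat) (Phi : 'M[R]_(M, N))
    (K q : nat) : R :=
  \big[Num.max/0]_(S : {set 'I_N} | #|S| == K)
    (\tr (gram_deviation Phi S ^+ (2 * q)) `^ ((2 * q)%:R^-1)).

Definition mutually_independent (R : realType) (d : measure_display)
    (Omega : measurableType d) (P : probability Omega R) (I : finType)
    (X : I -> {RV P >-> R}) : Prop :=
  forall (J : {set I}) (B : I -> set R), (forall i, measurable (B i)) ->
    P (\bigcap_(i in [set` J]) (X i @^-1` B i)) =
    (\prod_(i in J) P (X i @^-1` B i))%E.

(* [normal_prob] takes the standard deviation, not the variance. *)
Definition iid_gaussian_entries (R : realType) (d : measure_display)
    (Omega : measurableType d) (P : probability Omega R) (M N : nat)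
    (X : 'I_M * 'I_N -> {RV P >-> R}) : Prop :=
  mutually_independent X /\
  forall ij (B : set R), measurable B ->
    distribution P (X ij) B = normal_prob 0 (Num.sqrt (M%:R^-1)) B.

Definition sample_matrix (R : realType) (d : measure_display)
    (Omega : measurableType d) (P : probability Omega R) (M N : nat)
    (X : 'I_M * 'I_N -> {RV P >-> R}) (w : Omega) : 'M[R]_(M, N) :=
  \matrix_(i < M, j < N) X (i, j) w.

(* Main.v *)
Require Import Defs.
From HB Require Import structures.
From mathcomp Require Import all_boot all_order all_algebra.
From mathcomp Require Import all_classical all_reals all_analysis.
From mathcomp Require Import measurable_realfun ring lra.

Set Implicit Arguments.
Unset Strict Implicit.
Unset Printing Implicit Defensive.

Import Order.TTheory GRing.Theory Num.Theory.
Import numFieldNormedType.Exports.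

Local Open Scope classical_set_scope.
Local Open Scope ring_scope.

(* Put Q(x) = |Phi x|^2 - |x|^2 and delta' = delta K^(-1/(2q)). Since
   Tr[A^(2q)] <= K c^(2q) when the quadratic form of the symmetric K x K matrix A
   is bounded by c, it suffices that |Q(x)| <= delta' |x|^2 for all K-sparse x.
   Write L = K log(eN/K), so that M delta'^2 >= 81 L.

   Net. Rounding (5/2) sqrt(K) x to the nearest integer vector puts every
   K-sparse unit x at distance at most 1/5 from a multiple of an integer vector
   with at most K nonzero entries and l1 norm at most 3K. The parallelogram
   identity for Q then shows that it is enough to have |Q| <= (3/4) delta' |.|^2
   on these integer vectors, of which there are at most exp(L + (13/4) K).

   Tail. Integrating out the Gaussian entries one by one gives
   E exp(a |Phi y|^2) = (1 - 2 a |y|^2 / M)^(-M/2), so by Chernoff's bound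
   P(|Q(y)| > t |y|^2) <= 2 exp(-M t^2 / 10) for t <= 3/4. With t = (3/4) delta'
   the exponent is at least (729/160) L, and as L >= K and L >= log N the union
   bound leaves a failure probability of at most 2 N^(-1/4). *)

(** * Quadratic forms and traces *)

Definition dot (R : realType) (n : nat) (x y : 'cV[R]_n) : R :=
  \sum_(i < n) x i ord0 * y i ord0.

Section Dot.
Variables (R : realType) (n : nat).
Implicit Types (x y z : 'cV[R]_n) (a : R).

Lemma dotC x y : dot x y = dot y x.
Proof. by apply: eq_bigr => i _; rewrite mulrC. Qed.

Lemma dotDl x y z : dot (x + y) z = dot x z + dot y z.
Proof. by rewrite -big_split /=; apply: eq_bigr => i _; rewrite mxE mulrDl. Qed.

Lemma dotZl a x y : dot (a *: x) y = a * dot x y.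
Proof. by rewrite mulr_sumr; apply: eq_bigr => i _; rewrite mxE mulrA. Qed.

Lemma dotDr x y z : dot z (x + y) = dot z x + dot z y.
Proof. by rewrite dotC dotDl !(dotC z). Qed.

Lemma dotZr a x y : dot y (a *: x) = a * dot y x.
Proof. by rewrite dotC dotZl dotC. Qed.

Lemma dotNl x y : dot (- x) y = - dot x y.
Proof. by rewrite -scaleN1r dotZl mulN1r. Qed.

Lemma dotNr x y : dot y (- x) = - dot y x.
Proof. by rewrite dotC dotNl dotC. Qed.

Lemma dot0l x : dot 0 x = 0.
Proof. by rewrite /dot big1 // => i _; rewrite mxE mul0r. Qed.

Lemma dot_ge0 x : 0 <= dot x x.
Proof. by apply: sumr_ge0 => i _; rewrite -expr2 sqr_ge0. Qed.

Lemma dot_eq0 x : (dot x x == 0) = (x == 0).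
Proof.
apply/eqP/eqP => [|->]; last exact: dot0l.
move/eqP; rewrite psumr_eq0; last by move=> i _; rewrite -expr2 sqr_ge0.
move=> /allP h; apply/colP => i; rewrite mxE.
by have := h i (mem_index_enum i); rewrite -expr2 sqrf_eq0 => /eqP.
Qed.

Lemma dot_sqr_le x y : dot x y ^+ 2 <= dot x x * dot y y.
Proof.
have [->|y0] := eqVneq y 0.
  by rewrite dotC !dot0l expr0n mulr0.
have yy : 0 < dot y y by rewrite lt_neqAle dot_ge0 eq_sym dot_eq0 y0.
(* This vector is a multiple of the component of x orthogonal to y; its squared length is [dot y y]
   times the difference of the two sides. *)
have := dot_ge0 (dot y y *: x - dot x y *: y).
rewrite !(dotDl, dotDr, dotNl, dotNr, dotZl, dotZr) (dotC y x) => h.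
rewrite -subr_ge0 -(pmulr_rge0 _ yy); apply: le_trans h _.
by rewrite le_eqVlt; apply/orP; left; apply/eqP; ring.
Qed.

Lemma l2norm_sqr x : l2norm x ^+ 2 = dot x x.
Proof.
rewrite /l2norm sqr_sqrtr; first by apply: eq_bigr => i _; rewrite expr2.
by apply: sumr_ge0 => i _; rewrite sqr_ge0.
Qed.

End Dot.

Lemma dot_mulmx (R : realType) (m n : nat) (A : 'M[R]_(m, n)) x y :
  dot (A *m x) y = dot x (A^T *m y).
Proof.
have dotE p (u v : 'cV[R]_p) : dot u v = (u^T *m v) ord0 ord0.
  by rewrite mxE; apply: eq_bigr => i _; rewrite mxE.
by rewrite !dotE trmx_mul mulmxA.
Qed.

(** Cauchy-Schwarz in each row: the Frobenius norm dominates the operator norm. *)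
Lemma dot_mulmx_le (R : realType) (m n : nat) (A : 'M[R]_(m, n)) x :
  dot (A *m x) (A *m x) <= (\sum_i \sum_j A i j ^+ 2) * dot x x.
Proof.
rewrite mulr_suml; apply: ler_sum => i _.
set u : 'cV[R]_n := \col_j A i j.
have -> : (A *m x) i ord0 = dot u x.
  by rewrite mxE; apply: eq_bigr => j _; rewrite mxE.
have -> : \sum_j A i j ^+ 2 = dot u u.
  by apply: eq_bigr => j _; rewrite mxE expr2.
by rewrite -expr2 dot_sqr_le.
Qed.

(** * Powers of a symmetric matrix *)

Section SymmetricForm.
Variables (R : realType) (n : nat) (A : 'M[R]_n).
Hypothesis A_sym : A^T = A.

Let dotA x y : dot (A *m x) y = dot x (A *m y).
Proof. by rewrite dot_mulmx A_sym. Qed.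

Lemma trmx_exp_sym k : (A ^+ k)^T = A ^+ k.
Proof.
elim: k => [|k IH]; first by rewrite expr0 trmx1.
by rewrite exprS -mulmxE trmx_mul IH A_sym mulmxE -exprSr -exprS.
Qed.

(* Polarization, tested on the pair (c x, A x). *)
Lemma dot_sym_bound c : 0 <= c ->
  (forall x, `|dot (A *m x) x| <= c * dot x x) ->
  forall x, dot (A *m x) (A *m x) <= c ^+ 2 * dot x x.
Proof.
move=> c0 h x; set y := A *m x.
have key s : 4 * s * dot y y <= 2 * c * (s ^+ 2 * dot x x + dot y y).
  have /ler_normlP[_ h1] := h (s *: x + y).
  have /ler_normlP[h2 _] := h (s *: x - y).
  move: h1 h2.
  rewrite !(mulmxDr, mulmxN) -!scalemxAr -/y.
  rewrite !(dotDl, dotDr, dotNl, dotNr, dotZl, dotZr) (dotC y x) (dotA y x) -/y.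
  by move=> h1 h2; nra.
have [c1|c1] := eqVneq c 0.
  by have := key 1; have := dot_ge0 y; rewrite c1; nra.
have cp : 0 < c by rewrite lt_neqAle eq_sym c1.
have := key c => k1.
rewrite -(ler_pM2l cp); nra.
Qed.

Lemma dot_exp_bound c : 0 <= c ->
  (forall x, `|dot (A *m x) x| <= c * dot x x) ->
  forall k x, dot (A ^+ k *m x) (A ^+ k *m x) <= c ^+ (2 * k) * dot x x.
Proof.
move=> c0 h k; elim: k => [|k IH] x; first by rewrite muln0 !expr0 mul1r mul1mx.
rewrite exprSr -mulmxE -mulmxA; apply: le_trans (IH _) _.
by rewrite mulnS exprD (mulrC (c ^+ 2)) -mulrA ler_wpM2l ?exprn_ge0 // dot_sym_bound.
Qed.

(** As A^k is symmetric, the trace is its squared Frobenius norm. This replaces any use of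
    eigenvalues. *)
Lemma tr_exp_double k : \tr (A ^+ (2 * k)) = \sum_i \sum_j (A ^+ k) i j ^+ 2.
Proof.
rewrite mul2n -addnn exprD /mxtrace; apply: eq_bigr => i _.
rewrite mxE; apply: eq_bigr => j _.
by rewrite -{2}(trmx_exp_sym k) mxE expr2.
Qed.

Lemma tr_exp_double_ge0 k : 0 <= \tr (A ^+ (2 * k)).
Proof.
rewrite tr_exp_double !sumr_ge0 // => i _; rewrite sumr_ge0 // => j _.
by rewrite sqr_ge0.
Qed.

(** The squared Frobenius norm of A^k is summed over the columns A^k e_j, each of squared length at
    most c^(2k). *)
Lemma tr_exp_bound c : 0 <= c ->
  (forall x, `|dot (A *m x) x| <= c * dot x x) ->
  forall k, \tr (A ^+ (2 * k)) <= n%:R * c ^+ (2 * k).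
Proof.
move=> c0 h k; rewrite tr_exp_double exchange_big /=.
rewrite -[X in X%:R]card_ord mulr_natl -sumr_const; apply: ler_sum => j _.
have := dot_exp_bound c0 h k (delta_mx j ord0).
have -> : dot (delta_mx j ord0) (delta_mx j ord0) = 1 :> R.
  rewrite /dot (bigD1 j) //= mxE !eqxx mulr1 big1 ?addr0 // => i ij.
  by rewrite mxE (negPf ij) mul0r.
rewrite mulr1; apply: le_trans; rewrite le_eqVlt; apply/orP; left; apply/eqP.
by rewrite /dot -colE; apply: eq_bigr => i _; rewrite mxE expr2.
Qed.

(** These are the even moments of the spectral measure of A at x; only their log-convexity in k is
    used. *)
Let a k x := dot (A ^+ k *m x) (A ^+ k *m x).

Let a_logconvex k x : a k.+1 x ^+ 2 <= a k x * a k.+2 x.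
Proof.
have -> : a k.+1 x = dot (A ^+ k *m x) (A ^+ k.+2 *m x); last exact: dot_sqr_le.
by rewrite /a {1}exprS -mulmxE -mulmxA dotA mulmxA mulmxE -exprS.
Qed.

(** By log-convexity the ratios of consecutive terms are nondecreasing; cross-multiplying covers
    vanishing terms, since a zero term makes the next one zero. *)
Let a_ratio k x : a 1 x * a k x <= a k.+1 x * a 0 x.
Proof.
have a0 j : 0 <= a j x by exact: dot_ge0.
elim: k => [//|k IH]; have lc := a_logconvex k x.
have [ak|ak] := eqVneq (a k x) 0.
  move: lc; rewrite ak mul0r => lc.
  have /eqP : a k.+1 x ^+ 2 = 0 by apply/eqP; rewrite eq_le lc sqr_ge0.
  by rewrite sqrf_eq0 => /eqP ->; rewrite mulr0 mulr_ge0.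
have akp : 0 < a k x by rewrite lt_neqAle eq_sym ak a0.
rewrite -(ler_pM2l akp).
have h1 := ler_wpM2r (a0 k.+1) IH; have h2 := ler_wpM2r (a0 0%N) lc; lra.
Qed.

(** The product of the ratio bounds a_1 / a_0 <= a_(j+1) / a_j for j = 0, ..., k. *)
Lemma dot_sym_pow k x :
  dot (A *m x) (A *m x) ^+ k.+1 <= a k.+1 x * dot x x ^+ k.
Proof.
have -> : dot (A *m x) (A *m x) = a 1 x by rewrite /a expr1.
have -> : dot x x = a 0 x by rewrite /a expr0 mul1mx.
have a0 j : 0 <= a j x by exact: dot_ge0.
elim: k => [|k IH]; first by rewrite expr1 expr0 mulr1.
rewrite exprS; apply: le_trans (ler_wpM2l (a0 1%N) IH) _.
by rewrite mulrA (exprS (a 0 x)) mulrA ler_wpM2r ?exprn_ge0 ?a_ratio.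
Qed.

Lemma dot_exp_le_tr k x : a k x <= \tr (A ^+ (2 * k)) * dot x x.
Proof.
by rewrite tr_exp_double; exact: dot_mulmx_le.
Qed.

(** The form is bounded by the Schatten norm: Cauchy-Schwarz bounds it by |A x| |x|, [dot_sym_pow]
    passes to |A^(k+1) x|, and the Frobenius norm of A^(k+1) controls that. *)
Lemma form_pow_le_tr k x :
  `|dot (A *m x) x| ^+ (2 * k.+1) <= \tr (A ^+ (2 * k.+1)) * dot x x ^+ (2 * k.+1).
Proof.
rewrite {1}exprM real_normK ?num_real //.
have xx := dot_ge0 x.
apply: (@le_trans _ _ ((dot (A *m x) (A *m x) * dot x x) ^+ k.+1)).
  by apply: lerXn2r; rewrite ?nnegrE ?sqr_ge0 ?mulr_ge0 ?dot_ge0 ?dot_sqr_le.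
rewrite exprMn.
apply: le_trans (ler_wpM2r _ (dot_sym_pow k x)) _; first by rewrite exprn_ge0.
have -> : dot x x ^+ (2 * k.+1) = dot x x * (dot x x ^+ k * dot x x ^+ k.+1).
  by rewrite -exprD -exprS mul2n -addnn addSn.
by rewrite [leRHS]mulrA -[leLHS]mulrA ler_wpM2r ?mulr_ge0 ?exprn_ge0 ?dot_exp_le_tr.
Qed.

End SymmetricForm.

(** * Deviation of the squared norm and Gram matrices *)

Section Deviation.
Variables (R : realType) (M N : nat) (Phi : 'M[R]_(M, N)).

Definition deviation (x : 'cV[R]_N) : R :=
  dot (Phi *m x) (Phi *m x) - dot x x.

Lemma deviationZ a x : deviation (a *: x) = a ^+ 2 * deviation x.
Proof. by rewrite /deviation -scalemxAr !(dotZl, dotZr); ring. Qed.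

Lemma deviation_parallelogram x e :
  deviation (x + e) + deviation (x - e) = 2 * deviation x + 2 * deviation e.
Proof.
by rewrite /deviation !(mulmxDr, mulmxN) !(dotDl, dotDr, dotNl, dotNr); ring.
Qed.

(** A crude bound depending on Phi, for making a supremum finite and letting approximation errors
    vanish. *)
Lemma deviation_bounded : exists B, forall x, `|deviation x| <= B * dot x x.
Proof.
exists (\sum_i \sum_j Phi i j ^+ 2 + 1) => x.
have := dot_mulmx_le Phi x; have := dot_ge0 (Phi *m x); have := dot_ge0 x.
by rewrite /deviation ler_norml mulrDl mul1r => *; apply/andP; split; lra.
Qed.

Lemma RIPE (K : nat) (c : R) : RIP Phi K c <->
  forall x, sparse K x -> `|deviation x| <= c * dot x x.
Proof.
split=> h x sx; have := h x sx; rewrite !l2norm_sqr /deviation ler_norml.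
  by move=> /andP[h1 h2]; apply/andP; split; lra.
by move=> /andP[h1 h2]; apply/andP; split; lra.
Qed.

Section Support.
Variable S : {set 'I_N}.

(** The columns are the unit vectors e_i with i in S: [E] is an isometry onto the vectors supported
    on S, and it turns the form of the Gram deviation into [deviation]. *)
Let E : 'M[R]_(N, #|S|) := colsub (fun j : 'I_#|S| => enum_val j) 1%:M.

Let column_submatrixE : column_submatrix Phi S = Phi *m E.
Proof. by rewrite /E mulmx_colsub mulmx1. Qed.

Let E_ortho : E^T *m E = 1%:M.
Proof.
apply/matrixP => i j; rewrite !mxE (bigD1 (enum_val j)) //= big1 ?addr0.
  by rewrite !mxE eqxx mulr1 (inj_eq enum_val_inj) eq_sym.
by move=> k kj; rewrite !mxE (negPf kj) mulr0.
Qed.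

Let E_dot u : dot (E *m u) (E *m u) = dot u u.
Proof. by rewrite dot_mulmx mulmxA E_ortho mul1mx. Qed.

Let gram_form u :
  dot (gram_deviation Phi S *m u) u = deviation (E *m u).
Proof.
rewrite /gram_deviation column_submatrixE mulmxBl mul1mx dotDl dotNl.
by rewrite /deviation E_dot -[in LHS]mulmxA dotC -dot_mulmx -!mulmxA.
Qed.

Let E_supp (x : 'cV[R]_N) : (forall i, i \notin S -> x i ord0 = 0) ->
  x = E *m (E^T *m x).
Proof.
move=> h; have Ex j : (E^T *m x) j ord0 = x (enum_val j) ord0.
  rewrite mxE (bigD1 (enum_val j)) //= big1 ?addr0; first by rewrite !mxE eqxx mul1r.
  by move=> k kj; rewrite !mxE (negPf kj) mul0r.
apply/colP => i; rewrite mxE; under eq_bigr do rewrite Ex !mxE.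
have [iS|iS] := boolP (i \in S); last first.
  rewrite h // big1 // => j _; have [ij|] := eqVneq i (enum_val j); last by rewrite mul0r.
  by move: iS; rewrite ij enum_valP.
rewrite (bigD1 (enum_rank_in iS i)) //= enum_rankK_in // eqxx mul1r big1 ?addr0 //.
move=> j ji; have [ij|] := eqVneq i (enum_val j); last by rewrite mul0r.
by case/eqP: ji; apply: enum_val_inj; rewrite enum_rankK_in.
Qed.

Let E_sparse u : sparse #|S| (E *m u).
Proof.
rewrite /sparse subset_leq_card //; apply/fintype.subsetP => i; rewrite inE.
apply: contraNT => iS; rewrite mxE big1 // => j _; rewrite !mxE.
have [ij|] := eqVneq i (enum_val j); last by rewrite mul0r.
by move: iS; rewrite ij enum_valP.
Qed.

Lemma gram_deviation_sym : (gram_deviation Phi S)^T = gram_deviation Phi S.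
Proof. by rewrite /gram_deviation linearB /= trmx_mul trmxK trmx1. Qed.

Lemma deviation_le_tr q (x : 'cV[R]_N) : (0 < q)%N ->
  (forall i, i \notin S -> x i ord0 = 0) ->
  `|deviation x| <= \tr (gram_deviation Phi S ^+ (2 * q)) `^ ((2 * q)%:R^-1) * dot x x.
Proof.
case: q => // q _ /E_supp xE; rewrite {1 2 3}xE -gram_form E_dot.
have := form_pow_le_tr gram_deviation_sym q (E^T *m x).
set u := E^T *m x; set T := \tr _ => h.
have T0 : 0 <= T by apply: tr_exp_double_ge0; exact: gram_deviation_sym.
have n0 : (0 < 2 * q.+1)%N by [].
(* Comparing 2q-th powers removes the root of the trace. *)
rewrite -(ler_pXn2r n0) ?nnegrE ?mulr_ge0 ?powR_ge0 ?dot_ge0 //.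
rewrite exprMn -(powR_mulrn (2 * q.+1) (powR_ge0 _ _)) -powRrM mulVf ?pnatr_eq0 //.
by rewrite powRr1.
Qed.

(** Passing from the form to the trace costs the factor |S|^(1/(2q)), the source of the factor
    K^(1/q) in the bound on M. *)
Lemma tr_gram_deviation_le q (c : R) : (0 < q)%N -> 0 <= c ->
  (forall x, sparse #|S| x -> `|deviation x| <= c * dot x x) ->
  \tr (gram_deviation Phi S ^+ (2 * q)) `^ ((2 * q)%:R^-1)
    <= #|S|%:R `^ ((2 * q)%:R^-1) * c.
Proof.
move=> q0 c0 h; have n0 : (0 < 2 * q)%N by rewrite muln_gt0.
have le : \tr (gram_deviation Phi S ^+ (2 * q)) <= #|S|%:R * c ^+ (2 * q).
  apply: (tr_exp_bound gram_deviation_sym c0) => u.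
  by rewrite gram_form -E_dot; apply: h; exact: E_sparse.
 apply: (@le_trans _ _ ((#|S|%:R * c ^+ (2 * q)) `^ (2 * q)%:R^-1)).
  rewrite ge0_ler_powR ?invr_ge0 ?nnegrE ?ler0n ?mulr_ge0 ?exprn_ge0 //.
  by apply: tr_exp_double_ge0; exact: gram_deviation_sym.
rewrite powRM ?exprn_ge0 // -powR_mulrn // -powRrM mulfV ?powRr1 //.
by rewrite pnatr_eq0 -lt0n.
Qed.

End Support.

Lemma RIP_of_power_delta (K q : nat) (delta : R) : (0 < q)%N -> (K <= N)%N ->
  power_delta Phi K q <= delta -> RIP Phi K delta.
Proof.
move=> q0 KN; move/bigmax_leP => [_ h]; apply/RIPE => x sx.
pose T := [set i | x i ord0 != 0]%SET.
have TK : (#|T| <= K)%N by apply: leq_trans sx; rewrite cardsE.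
(* The maximum runs over sets of exactly K indices, so the support T is completed by K - |T| others;
   they exist because K <= N makes a binomial coefficient positive. *)
have [S TS SK] : exists2 S : {set 'I_N}, T \subset S & #|S| = K.
  have [B] : exists B, B \in [set B : {set 'I_N} | (B \subset ~: T) && (#|B| == (K - #|T|)%N)]%SET.
    apply/set0Pn; rewrite -card_gt0 cards_draws bin_gt0 (cardsCs (~: T)) finset.setCK card_ord.
    by rewrite leq_sub2r.
  rewrite inE => /andP[BT /eqP Bc]; exists (T :|: B).
    exact: finset.subsetUl.
  rewrite cardsU Bc (disjoint_setI0 _) ?cards0 ?subn0 ?subnKC //.
  by rewrite disjoint_sym finset.disjoints_subset.
apply: le_trans (deviation_le_tr q0 (_ : forall i, i \notin S -> x i ord0 = 0)) _.
  move=> i iS; apply/eqP; apply: contraNT iS => xi.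
  by apply: (fintype.subsetP TS); rewrite inE.
by rewrite ler_wpM2r ?dot_ge0 // h // SK.
Qed.

Lemma power_delta_le (K q : nat) (c : R) : (0 < q)%N -> 0 <= c ->
  (forall x, sparse K x -> `|deviation x| <= c * dot x x) ->
  power_delta Phi K q <= K%:R `^ ((2 * q)%:R^-1) * c.
Proof.
move=> q0 c0 h; apply/bigmax_leP; split; first by rewrite mulr_ge0 ?powR_ge0.
by move=> S /eqP SK; rewrite -SK; apply: tr_gram_deviation_le => //; rewrite SK.
Qed.

End Deviation.

(** * Independent blocks of random variables *)

Section BlockIndependence.
Local Open Scope ereal_scope.
Context (d : measure_display) (Omega : measurableType d) (R : realType).
Variables (P : probability Omega R) (I : finType) (X : I -> {RV P >-> R}).
Hypothesis X_indep : mutually_independent X.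
Variable J : {set I}.

Definition cylinders : set (set Omega) :=
  [set A | exists2 B : I -> set R, (forall i, measurable (B i)) &
     A = \bigcap_(i in [set` J]) (X i @^-1` B i)].

(** The space Omega with the coarser sigma-algebra generated by the X_j, j in J. Measurability on
    [block] thus means being a function of these variables, and [to_block] is the identity. *)
Definition block : measurableType _ := g_sigma_algebraType cylinders.

Let cylindersI : setI_closed cylinders.
Proof.
move=> _ _ [B mB ->] [C mC ->]; exists (fun i => B i `&` C i).
  by move=> i; exact: measurableI.
by rewrite -bigcapI; apply: eq_bigcapr => i _; rewrite preimage_setI.
Qed.

Let cylinders_measurable A : cylinders A -> measurable A.
Proof.
move=> [B mB ->]; apply: fin_bigcap_measurable => // i _.
by rewrite -[_ @^-1` _]setTI; exact: measurable_funP.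
Qed.

Lemma block_measurable (A : set block) : measurable A -> (measurable (A : set Omega)).
Proof.
apply: smallest_sub; first exact: sigma_algebra_measurable.
exact: cylinders_measurable.
Qed.

Lemma measurable_block (j : I) : j \in J -> measurable_fun [set: block] (X j : block -> R).
Proof.
move=> jJ _ B mB; rewrite setTI; apply: sub_sigma_algebra.
exists (fun i => if i == j then B else setT); first by move=> i; case: ifP.
apply/seteqP; split => [w Bw i _|w /(_ j jJ)] /=; last by rewrite eqxx.
by case: eqP => [->|].
Qed.

Definition to_block (w : Omega) : block := w.

Lemma measurable_to_block : measurable_fun [set: Omega] to_block.
Proof. by move=> _ B mB; rewrite setTI; exact: block_measurable. Qed.

HB.instance Definition _ :=
  isMeasurableFun.Build _ _ _ _ to_block measurable_to_block.

Variable k : I.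
Hypothesis kJ : k \notin J.

Let cylinder_indep A B : cylinders A -> measurable B ->
  P (A `&` X k @^-1` B) = P A * P (X k @^-1` B).
Proof.
move=> [C mC ->] mB.
(* As k is outside J, this family prescribes B at k and agrees with C on J; independence is then
   applied to J and to J with k added. *)
pose C' i := if i == k then B else C i.
have mC' i : measurable (C' i) by rewrite /C'; case: ifP.
have kC' : C' k = B by rewrite /C' eqxx.
have JC' i : i \in J -> C' i = C i.
  by move=> iJ; rewrite /C' ifN //; apply: contraNneq kJ => <-.
have := X_indep (k |: J) mC'; rewrite big_setU1//= kC'.
have -> : (\prod_(i in J) P (X i @^-1` C' i) = \prod_(i in J) P (X i @^-1` C i)).
  by apply: eq_bigr => i iJ; rewrite JC'.
rewrite -X_indep // muleC => <-; congr (P _).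
apply/seteqP; split => w /=.
  move=> [h1 h2] i /=; rewrite in_setU1 => /orP[/eqP ->|iJ]; first by rewrite kC'.
  by rewrite JC' //; apply: h1.
move=> h; split; last by have := h k; rewrite /= in_setU1 eqxx kC'; exact.
by move=> i iJ; have := h i; rewrite /= in_setU1 iJ orbT JC' //; exact.
Qed.

(** Both sides are finite measures in A that agree on the cylinders, a pi-system containing the
    whole space. *)
Let block_indep (A : set block) B : measurable A -> measurable B ->
  P ((A : set Omega) `&` X k @^-1` B) = P (A : set Omega) * P (X k @^-1` B).
Proof.
move=> mA mB.
have mX : measurable (X k @^-1` B).
  by rewrite -[_ @^-1` _]setTI; exact: measurable_funP.
have p0 : (0 <= fine (P (X k @^-1` B)))%R by rewrite fine_ge0.
have pE : (fine (P (X k @^-1` B)))%:E = P (X k @^-1` B) by rewrite fineK ?fin_num_measure.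
have := @g_sigma_algebra_measure_unique _ R _ cylinders cylinders_measurable
  (fun=> setT) _ _ (mrestr P mX) (mscale (NngNum p0) P) cylindersI _ _ A mA.
rewrite /= /mrestr /mscale /= pE muleC; apply.
- by move=> _; exists (fun=> setT) => //; apply/seteqP; split.
- by rewrite bigcup_const.
- by move=> {mA}A GA; rewrite cylinder_indep // muleC.
- by move=> _; rewrite setTI (le_lt_trans (probability_le1 _ _)) ?ltry.
Qed.

(** The joint law of [to_block] and X_k is the product of the two laws, so Tonelli integrates X_k
    out with the block held fixed. *)
Lemma integral_block_indep (h : block * R -> \bar R) :
  measurable_fun setT h -> (forall z, 0 <= h z) ->
  \int[P]_w h (w, X k w) = \int[P]_w \int[distribution P (X k)]_x h (w, x).
Proof.
move=> mh h0.
pose m1 := distribution P to_block; pose m2 := distribution P (X k).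
pose pr w : block * R := (to_block w, X k w).
have mpr : measurable_fun setT pr by apply/measurable_fun_pair.
pose prm : {mfun Omega >-> (block * R)%type} :=
  HB.pack pr (isMeasurableFun.Build _ _ _ _ pr mpr).
have E Y : measurable Y -> (m1 \x m2) Y = distribution P prm Y.
  apply: product_measure_unique => A B mA mB.
  exact: block_indep.
transitivity (\int[distribution P prm]_z h z).
  by rewrite ge0_integral_distribution.
transitivity (\int[m1 \x m2]_z h z).
  apply: eq_measure_integral => Y mY _; exact/esym/E.
rewrite fubini_tonelli1 // /fubini_F ge0_integral_distribution //.
  exact: measurable_fun_fubini_tonelli_F.
by move=> w; apply: integral_ge0 => x _.
Qed.

End BlockIndependence.

(** * Gaussian integrals *)

(** The exponent of exp(a (u + y x)^2) against a centred Gaussian density of variance s^2: what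
    remains in x is Gaussian with variance s^2 / D. *)
Lemma complete_square (F : realFieldType) (a s u y x D : F) :
  s != 0 -> D != 0 -> D = 1 - 2 * a * s ^+ 2 * y ^+ 2 ->
  a * (u + y * x) ^+ 2 - x ^+ 2 / (s ^+ 2 *+ 2) =
  a / D * u ^+ 2 - (x - 2 * a * u * y * s ^+ 2 / D) ^+ 2 * D / (s ^+ 2 *+ 2).
Proof.
rewrite -(mulr_natr (s ^+ 2)) => s0 D0 DE.
have D1 : 1 - 2 * a * s ^+ 2 * y ^+ 2 != 0 by rewrite -DE.
by rewrite {}DE in D0 *; field; rewrite s0 D1.
Qed.

Section NormalIntegral.
Local Open Scope ereal_scope.
Variable R : realType.
Notation mu := (@lebesgue_measure R).

(** Change of variables yields the Radon-Nikodym derivative, which equals the Gaussian density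
    almost everywhere because both have the same integrals over measurable sets. *)
Lemma ge0_integral_normal_prob (m s : R) (f : R -> \bar R) :
  measurable_fun setT f -> (forall x, 0 <= f x) ->
  \int[normal_prob m s]_x f x = \int[mu]_x (f x * (normal_pdf m s x)%:E).
Proof.
move=> mf f0; have dom := normal_prob_dominates m s.
rewrite -(Radon_Nikodym_SigmaFinite.change_of_variables dom)//=.
have iRN := Radon_Nikodym_SigmaFinite.f_integrable dom.
have mpdf : measurable_fun setT (EFin \o normal_pdf m s).
  by apply/measurable_EFinP; exact: measurable_normal_pdf.
apply: ae_eq_integral => //.
- by apply: emeasurable_funM => //; exact: measurable_int iRN.
- exact: emeasurable_funM.
- apply: ae_eqe_mul2l; apply: integral_ae_eq => //=.
  by move=> E _ mE; rewrite -Radon_Nikodym_SigmaFinite.f_integral.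
Qed.

Local Open Scope ring_scope.

Lemma normal_prob_expR_sqr (s a u y : R) : s != 0 -> 0 < 1 - 2 * a * s ^+ 2 * y ^+ 2 ->
  (\int[normal_prob 0 s]_x (expR (a * (u + y * x) ^+ 2))%:E =
  ((Num.sqrt (1 - 2 * a * s ^+ 2 * y ^+ 2))^-1 *
    expR (a / (1 - 2 * a * s ^+ 2 * y ^+ 2) * u ^+ 2))%:E)%E.
Proof.
move=> s0; set D := 1 - _ => D0.
set r := Num.sqrt D; have r0 : 0 < r by rewrite sqrtr_gt0.
have rD : D = r ^+ 2 by rewrite sqr_sqrtr // ltW.
(* Standard deviation and mean of the Gaussian left after completing the square; its density
   integrates to 1. *)
pose tau := s / r; pose m := 2 * a * u * y * s ^+ 2 / D.
have tau0 : tau != 0 by rewrite /tau mulf_neq0 // invr_neq0 // gt_eqF.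
rewrite ge0_integral_normal_prob; first last.
- by move=> x; rewrite lee_fin expR_ge0.
- apply/measurable_EFinP; apply: measurableT_comp => //.
  apply: measurable_funM => //; apply: measurable_funX.
  by apply: measurable_funD => //; apply: measurable_funM.
transitivity (\int[mu]_x ((r^-1 * expR (a / D * u ^+ 2))%:E * (normal_pdf m tau x)%:E))%E.
  apply: eq_integral => x _; rewrite -!EFinM; congr EFin.
  rewrite !normal_pdfE // /normal_peak /normal_fun.
  have -> : Num.sqrt (tau ^+ 2 * pi *+ 2) = Num.sqrt (s ^+ 2 * pi *+ 2) / r.
    have -> : tau ^+ 2 * pi *+ 2 = (s ^+ 2 * pi *+ 2) * (r^-1) ^+ 2.
      by rewrite /tau exprMn mulrAC mulrnAl.
    rewrite sqrtrM; first by rewrite sqrtr_sqr ger0_norm // invr_ge0 ltW.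
    by rewrite mulrn_wge0 // mulr_ge0 ?sqr_ge0 ?pi_ge0.
  rewrite invfM invrK mulrCA -expRD.
  rewrite [RHS](_ : _ = (r^-1 * r) * (Num.sqrt (s ^+ 2 * pi *+ 2))^-1 *
    (expR (a / D * u ^+ 2) * expR (- (x - m) ^+ 2 / (tau ^+ 2 *+ 2)))); last by ring.
  rewrite mulVf ?gt_eqF // mul1r -expRD; congr (_ * expR _).
  have := complete_square u x s0 (lt0r_neq0 D0) (erefl D).
  rewrite -/m subr0 !mulNr => ->; congr (_ - _).
  by rewrite /tau exprMn exprVn -rD -(mulrnAl (s ^+ 2)) invfM invrK -!mulrA (mulrC D).
rewrite ge0_integralZl//; first by rewrite integral_normal_pdf mule1.
- by apply/measurable_EFinP; exact: measurable_normal_pdf.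
- by move=> x _; rewrite lee_fin normal_pdf_ge0.
- by rewrite lee_fin mulr_ge0 ?expR_ge0 ?invr_ge0 ?sqrtr_ge0.
Qed.

End NormalIntegral.

Lemma integral_normal_distribution (R : realType) (d : measure_display)
    (Omega : measurableType d) (P : probability Omega R) (X : {RV P >-> R})
    (m s : R) (f : R -> \bar R) :
  (forall B : set R, measurable B -> distribution P X B = normal_prob m s B) ->
  measurable_fun setT f -> (forall x, 0 <= f x)%E ->
  (\int[distribution P X]_x f x = \int[normal_prob m s]_x f x)%E.
Proof.
move=> XE mf f0.
have mX : measurable_fun [set: Omega] (X : Omega -> measurableTypeR R).
  by move=> _ B mB; exact: (measurable_funP X measurableT B mB).
(* The same variable with codomain [measurableTypeR R], so that equality of laws on measurable sets
   carries over to integrals. *)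
pose X' : {mfun Omega >-> measurableTypeR R} :=
  HB.pack (X : Omega -> measurableTypeR R) (isMeasurableFun.Build _ _ _ _ _ mX).
transitivity (\int[P]_w f (X w))%E; first by rewrite ge0_integral_distribution.
transitivity (\int[distribution P X']_x f x)%E.
  by rewrite ge0_integral_distribution.
by apply: eq_measure_integral => B mB _; exact: XE.
Qed.

Lemma measurable_sum_cond (d : measure_display) (T : measurableType d)
    (R : realType) (D : set T) (I : Type) (r : seq I) (A : pred I) (h : I -> T -> R) :
  (forall i, A i -> measurable_fun D (h i)) ->
  measurable_fun D (fun x => \sum_(i <- r | A i) h i x).
Proof.
move=> mh; under eq_fun do rewrite big_mkcond.
by apply: measurable_sum => i; have [/mh|_] := boolP (A i).
Qed.

(** * Exponential moments of the squared norm *)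

Section GaussianMatrix.
Context (R : realType) (d : measure_display) (Omega : measurableType d).
Variables (P : probability Omega R) (M N : nat).
Variable X : 'I_M * 'I_N -> {RV P >-> R}.
Hypothesis X_iid : iid_gaussian_entries X.

Let s : R := Num.sqrt (M%:R^-1).

Section Mgf.
Variable y : 'I_N -> R.

(** The contribution of the entries in J to the i-th coordinate of Phi y; [mass] is the matching
    share of |y|^2. The weights in [mgf] depend on the row because each integration changes one row
    only. *)
Let part (J : {set 'I_M * 'I_N}) (i : 'I_M) (w : Omega) : R :=
  \sum_(l | (i, l) \in J) y l * X (i, l) w.
Let mass (J : {set 'I_M * 'I_N}) (i : 'I_M) : R := \sum_(l | (i, l) \in J) y l ^+ 2.

Let mgf (a : 'I_M -> R) (J : {set 'I_M * 'I_N}) : \bar R :=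
  (\int[P]_w (expR (\sum_i a i * part J i w ^+ 2))%:E)%E.

Let partU1 i0 l0 (J : {set 'I_M * 'I_N}) i w : (i0, l0) \notin J ->
  part ((i0, l0) |: J) i w =
  (if i == i0 then y l0 * X (i0, l0) w else 0) + part J i w.
Proof.
move=> kJ; rewrite /part; have [->|ii0] := eqVneq i i0.
  rewrite (bigD1 l0) /=; last by rewrite in_setU1 eqxx.
  congr (_ + _); apply: eq_bigl => l; rewrite in_setU1 xpair_eqE eqxx /=.
  by have [->|//] := eqVneq l l0; rewrite /= ?(negPf kJ) // andbT.
rewrite add0r; apply: eq_bigl => l.
by rewrite in_setU1 xpair_eqE (negPf ii0).
Qed.

Let massU1 i0 l0 (J : {set 'I_M * 'I_N}) i : (i0, l0) \notin J ->
  mass ((i0, l0) |: J) i = (if i == i0 then y l0 ^+ 2 else 0) + mass J i.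
Proof.
move=> kJ; rewrite /mass; have [->|ii0] := eqVneq i i0.
  rewrite (bigD1 l0) /=; last by rewrite in_setU1 eqxx.
  congr (_ + _); apply: eq_bigl => l; rewrite in_setU1 xpair_eqE eqxx /=.
  by have [->|//] := eqVneq l l0; rewrite /= ?(negPf kJ) // andbT.
rewrite add0r; apply: eq_bigl => l.
by rewrite in_setU1 xpair_eqE (negPf ii0).
Qed.

Let mass_ge0 J i : 0 <= mass J i.
Proof. by apply: sumr_ge0 => l _; exact: sqr_ge0. Qed.

Let measurable_part J i : measurable_fun [set: block X J] (part J i).
Proof.
by apply: measurable_sum_cond => l lJ; apply: measurable_funM => //; exact: measurable_block.
Qed.

(* Integrating out one entry turns the quadratic weight [a] of its row into
   [a / (1 - 2 a s^2 y^2)], and the resulting factors telescope. *)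
Lemma mgf_rows (J : {set 'I_M * 'I_N}) (a : 'I_M -> R) :
  (0 < M)%N ->
  (forall i, 0 < 1 - 2 * a i * s ^+ 2 * mass J i) ->
  mgf a J = (\prod_i (Num.sqrt (1 - 2 * a i * s ^+ 2 * mass J i))^-1)%:E.
Proof.
move=> M0; have [n] := ubnP #|J|; elim: n => // n IH in J a *.
rewrite ltnS => Jn h.
have s0 : s != 0 by rewrite gt_eqF // sqrtr_gt0 invr_gt0 ltr0n.
have [J0|[[i0 l0] kJ]] := set_0Vmem J.
  have p0 i w : part J i w = 0 by rewrite /part big1 // => l; rewrite J0 inE.
  have m0 i : mass J i = 0 by rewrite /mass big1 // => l; rewrite J0 inE.
  rewrite /mgf big1; last by move=> i _; rewrite m0 mulr0 subr0 sqrtr1 invr1.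
  under eq_integral => w _.
    rewrite big1; last by move=> i _; rewrite p0 expr0n mulr0.
    rewrite expR0; over.
  by rewrite integral_cst // mul1e; exact: probability_setT.
pose J' := J :\ (i0, l0).
have kJ' : (i0, l0) \notin J' by rewrite !inE eqxx.
have JE : J = (i0, l0) |: J' by rewrite finset.setD1K.
have J'n : (#|J'| < n)%N by move: Jn; rewrite (cardsD1 (i0, l0)) kJ add1n.
move: h; rewrite JE => h {Jn kJ}.
pose D := 1 - 2 * a i0 * s ^+ 2 * y l0 ^+ 2.
have hi0 : 0 < D - 2 * a i0 * s ^+ 2 * mass J' i0.
  by have := h i0; rewrite massU1 // eqxx; congr (_ < _); rewrite /D; ring.
(* For a nonnegative weight D is at least the positive quantity of [hi0]; for a negative one it is
   at least 1. *)
have D0 : 0 < D.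
  have s2 : 0 <= s ^+ 2 * mass J' i0 by rewrite mulr_ge0 ?sqr_ge0 ?mass_ge0.
  have [a0|a0] := leP 0 (a i0).
    by have := mulr_ge0 a0 s2; lra.
  have : 0 <= s ^+ 2 * y l0 ^+ 2 by rewrite mulr_ge0 ?sqr_ge0.
  rewrite /D; nra.
pose a' i := if i == i0 then a i0 / D else a i.
pose rest w := \sum_(i | i != i0) a i * part J' i w ^+ 2.
(* The integrand with the entry (i0, l0) as a separate variable; [rest] collects the other rows,
   which do not involve it. *)
pose g (z : block X J' * R) :=
  (expR (rest z.1 + a i0 * (part J' i0 z.1 + y l0 * z.2) ^+ 2))%:E.
have mg : measurable_fun setT g.
  have mrest : measurable_fun [set: block X J'] rest.
    apply: measurable_sum_cond => i _; apply: measurable_funM => //.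
    by apply: measurable_funX; exact: measurable_part.
  apply/measurable_EFinP; apply: measurableT_comp => //.
  apply: measurable_funD; first exact: measurableT_comp mrest measurable_fst.
  apply: measurable_funM => //; apply: measurable_funX.
  apply: measurable_funD; last by apply: measurable_funM.
  have mp : measurable_fun [set: block X J'] (part J' i0) by exact: measurable_part.
  exact: measurableT_comp mp measurable_fst.
have step w : (\int[distribution P (X (i0, l0))]_x g (w, x) =
    ((Num.sqrt D)^-1)%:E * (expR (\sum_i a' i * part J' i w ^+ 2))%:E)%E.
  have mw : measurable_fun [set: R] (fun x => (expR (a i0 * (part J' i0 w + y l0 * x) ^+ 2))%:E).
    apply/measurable_EFinP; apply: measurableT_comp => //.
    apply: measurable_funM => //; apply: measurable_funX.
    by apply: measurable_funD => //; apply: measurable_funM.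
  under eq_integral => x _ do rewrite /g /= expRD EFinM.
  rewrite ge0_integralZl ?lee_fin ?expR_ge0 //.
  rewrite (integral_normal_distribution (X_iid.2 _)) // -/s.
  rewrite normal_prob_expR_sqr // -/D -!EFinM; congr EFin.
  rewrite mulrCA -expRD; congr (_ * expR _).
  rewrite [RHS](bigD1 i0) //= addrC /a' eqxx; congr (_ + _).
  by apply: eq_bigr => i /negPf ->.
transitivity (\int[P]_w g (w, X (i0, l0) w))%E.
  apply: eq_integral => w _; rewrite /g /=; congr (expR _)%:E.
  rewrite (bigD1 i0) //= addrC partU1 // eqxx [X in a i0 * X ^+ 2]addrC; congr (_ + _).
  by apply: eq_bigr => i /negPf ii0; rewrite partU1 // ii0 add0r.
rewrite (integral_block_indep X_iid.1 kJ' mg); last by move=> z; rewrite lee_fin expR_ge0.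
under eq_integral => w _ do rewrite step.
rewrite ge0_integralZl //; last first.
  apply/measurable_EFinP; apply: measurableT_comp => //.
  apply: measurable_sum => i; apply: measurable_funM => //; apply: measurable_funX.
  by apply: measurable_sum_cond => l _; apply: measurable_funM.
have E0 : 1 - 2 * a' i0 * s ^+ 2 * mass J' i0 = (D - 2 * a i0 * s ^+ 2 * mass J' i0) / D.
  by rewrite /a' eqxx; field; rewrite gt_eqF.
have h' i : 0 < 1 - 2 * a' i * s ^+ 2 * mass J' i.
  have [->|ii0] := eqVneq i i0; first by rewrite E0 divr_gt0.
  by have := h i; rewrite massU1 // /a' (negPf ii0) add0r.
rewrite -/(mgf a' J') (IH J' a' J'n h') -EFinM; congr EFin.
rewrite (bigD1 i0) //= [RHS](bigD1 i0) //= mulrA; congr (_ * _).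
  rewrite E0 massU1 // eqxx mulrDr opprD addrA -/D -invfM -sqrtrM ?ltW //.
  by congr (Num.sqrt _)^-1; field; rewrite gt_eqF.
by apply: eq_bigr => i /negPf ii0; rewrite massU1 // ii0 add0r /a' ii0.
Qed.

End Mgf.
End GaussianMatrix.

(** * Chernoff bounds *)

(** With v = s - s^2/5, exp(v) >= (1 + v/3)^3, whose excess over 1 + s is s^2 times a factor that is
    nonnegative on this interval. *)
Lemma expR_ge_succ_sub_sqr (R : realType) (s : R) : -(3/4) <= s <= 3/4 ->
  1 + s <= expR (s - s ^+ 2 / 5).
Proof.
move=> /andP[s1 s2]; set v := s - s ^+ 2 / 5.
have v3 : 0 <= 1 + v / 3 by rewrite /v; nra.
have -> : v = 3%:R * (v / 3) by field.
rewrite expRM_natl; apply: (@le_trans _ _ ((1 + v / 3) ^+ 3)); last first.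
  by rewrite lerXn2r ?nnegrE ?expR_ge0 // expR_ge1Dx.
have -> : (1 + v / 3) ^+ 3 = 1 + s + s ^+ 2 *
    ((1 - s / 5) ^+ 2 / 3 + s * (1 - s / 5) ^+ 3 / 27 - 1 / 5).
  by rewrite /v; field.
rewrite lerDl mulr_ge0 ?sqr_ge0 //.
have h : 17/20 <= 1 - s / 5 <= 23/20 by lra.
have [h1 h2] : (17/20) ^+ 2 <= (1 - s / 5) ^+ 2 /\ (1 - s / 5) ^+ 3 <= 2.
  by move/andP: h => [h1 h2]; split; nra.
have h3 : 0 <= (1 - s / 5) ^+ 3 by rewrite exprn_ge0 //; lra.
nra.
Qed.

Section MeasurableComparison.
Context (R : realType) (d : measure_display) (T : measurableType d).
Variables f g : T -> R.
Hypotheses (mf : measurable_fun setT f) (mg : measurable_fun setT g).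

Lemma measurable_set_ler : measurable [set w | f w <= g w].
Proof.
have := measurable_fun_ler mf mg measurableT (_ : measurable [set true]).
by rewrite setTI; apply.
Qed.

Lemma measurable_set_ltr : measurable [set w | f w < g w].
Proof.
have := measurable_fun_ltr mf mg measurableT (_ : measurable [set true]).
by rewrite setTI; apply.
Qed.

End MeasurableComparison.

Section Chernoff.
Context (R : realType) (d : measure_display) (Omega : measurableType d).
Variables (P : probability Omega R) (M N : nat).
Variable X : 'I_M * 'I_N -> {RV P >-> R}.

Let Z (y : 'cV[R]_N) (w : Omega) : R :=
  dot (sample_matrix X w *m y) (sample_matrix X w *m y).

Let ZE y w : Z y w =
  \sum_i (\sum_(l | (i, l) \in [set: 'I_M * 'I_N]%SET) y l ord0 * X (i, l) w) ^+ 2.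
Proof.
apply: eq_bigr => i _; rewrite -expr2; congr (_ ^+ 2); rewrite mxE.
by apply: eq_big => [l|l _]; rewrite ?inE // mxE mulrC.
Qed.

Lemma measurable_sqnorm_sample y : measurable_fun [set: Omega] (Z y).
Proof.
rewrite (funext (ZE y)).
apply: measurable_sum => i; apply: measurable_funX.
by apply: measurable_sum_cond => l _; apply: measurable_funM.
Qed.

Lemma measurable_deviation y :
  measurable_fun [set: Omega] (fun w => deviation (sample_matrix X w) y).
Proof. by apply: measurable_funD => //; exact: measurable_sqnorm_sample. Qed.

Hypothesis X_iid : iid_gaussian_entries X.
Hypothesis M0 : (0 < M)%N.

Lemma mgf_sqnorm_sample y (a : R) : 0 < 1 - 2 * a / M%:R * dot y y ->
  (\int[P]_w (expR (a * Z y w))%:E =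
   ((Num.sqrt (1 - 2 * a / M%:R * dot y y))^-1 ^+ M)%:E)%E.
Proof.
move=> h.
have E i : 1 - 2 * a * Num.sqrt M%:R^-1 ^+ 2 *
    (\sum_(l | (i, l) \in [set: 'I_M * 'I_N]%SET) y l ord0 ^+ 2) =
    1 - 2 * a / M%:R * dot y y.
  rewrite sqr_sqrtr ?invr_ge0 //; congr (1 - _ * _).
  by apply: eq_big => [l|l _]; rewrite ?inE // expr2.
under eq_integral => w _ do rewrite ZE mulr_sumr.
have := @mgf_rows _ _ _ _ _ _ _ X_iid (fun l => y l ord0) [set: _]%SET (fun=> a) M0.
move=> -> //; last by move=> i; rewrite E.
by congr EFin; under eq_bigr do rewrite E; rewrite prodr_const card_ord.
Qed.

(** The value of a is the optimal Chernoff parameter, for which 1 - 2 a |y|^2 / M = 1 / (1 + s). It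
    has the sign of s, so one statement covers both tails. *)
Lemma sqnorm_sample_tail y (s a : R) : -(3/4) <= s <= 3/4 -> y != 0 ->
  a = s / (1 + s) * M%:R / 2 / dot y y ->
  (P [set w | a * ((1 + s) * dot y y) <= a * Z y w]%R <=
   (expR (- (M%:R * s ^+ 2 / 10)))%:E)%E.
Proof.
move=> hs y0 aE; have n0 : 0 < dot y y by rewrite lt_neqAle eq_sym dot_eq0 y0 dot_ge0.
have s1 : 0 < 1 + s by move/andP: hs => []; lra.
have m0 : 0 < M%:R :> R by rewrite ltr0n.
have uE : 1 - 2 * a / M%:R * dot y y = (1 + s)^-1.
  by rewrite aE; field; rewrite !gt_eqF.
have := @mgf_sqnorm_sample y a; rewrite uE invr_gt0 => /(_ s1) EZ.
have maZ : measurable_fun [set: Omega] (fun w => a * Z y w).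
  by apply: measurable_funM => //; exact: measurable_sqnorm_sample.
pose Y : {RV P >-> R} := HB.pack (fun w => a * Z y w) (isMeasurableFun.Build _ _ _ _ _ maZ).
(* The parameter is 1 since a, possibly negative, is already part of [Y]. *)
apply: le_trans (chernoff Y (a * ((1 + s) * dot y y)) ltr01) _.
rewrite /mmt_gen_fun unlock /=.
under eq_integral => w _ do rewrite /= mulr1.
rewrite EZ -EFinM lee_fin.
have -> : 1 * (a * ((1 + s) * dot y y)) = M%:R * (s / 2).
  by rewrite aE; field; rewrite !gt_eqF.
rewrite sqrtrV ?invrK; last exact: ltW.
have -> : - (M%:R * (s / 2)) = M%:R * (- (s / 2)) by ring.
have -> : - (M%:R * s ^+ 2 / 10) = M%:R * (- (s ^+ 2 / 10)) by ring.
rewrite !expRM_natl -exprMn; apply: lerXn2r;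
  rewrite ?nnegrE ?mulr_ge0 ?expR_ge0 ?sqrtr_ge0 //.
rewrite expRN ler_pdivrMr ?expR_gt0 // -expRD.
apply: le_trans (ler_wsqrtr (expR_ge_succ_sub_sqr hs)) _.
have -> : s - s ^+ 2 / 5 = 2%:R * (- (s ^+ 2 / 10) + s / 2) by field.
by rewrite expRM_natl sqrtr_sqr ger0_norm ?expR_ge0.
Qed.

(** The event lies in the union of the upper tail s = t and the lower tail s = -t; for y = 0 it is
    empty. *)
Lemma deviation_tail y (t : R) : 0 < t <= 3/4 ->
  (P [set w | t * dot y y < `|deviation (sample_matrix X w) y|]%R <=
   (2 * expR (- (M%:R * t ^+ 2 / 10)))%:E)%E.
Proof.
move=> /andP[t0 t34]; have [->|y0] := eqVneq y 0.
  rewrite (_ : [set w | _] = set0) ?measure0 ?lee_fin ?mulr_ge0 ?expR_ge0 //.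
  apply/seteqP; split => // w /=; rewrite /deviation mulmx0.
  by rewrite !dot0l mulr0 subrr normr0 ltxx.
have n0 : 0 < dot y y by rewrite lt_neqAle eq_sym dot_eq0 y0 dot_ge0.
have m0 : 0 < M%:R :> R by rewrite ltr0n.
pose a s := s / (1 + s) * M%:R / 2 / dot y y.
pose A s := [set w | a s * ((1 + s) * dot y y) <= a s * Z y w].
have mA s : measurable (A s).
  apply: measurable_set_ler => //.
  by apply: measurable_funM => //; exact: measurable_sqnorm_sample.
have PA s : -(3/4) <= s <= 3/4 -> s ^+ 2 = t ^+ 2 ->
    (P (A s) <= (expR (- (M%:R * t ^+ 2 / 10)))%:E)%E.
  by move=> hs <-; exact: sqnorm_sample_tail.
apply: (@le_trans _ _ (P (A t `|` A (- t)))).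
  apply: le_measure; rewrite ?inE.
  - apply: measurable_set_ltr => //.
    by apply: measurableT_comp => //; exact: measurable_deviation.
  - exact: measurableU.
  move=> w /=; rewrite ltNge ler_norml negb_and -!ltNge /deviation -/(Z y w).
  move=> /orP[h|h]; [right|left]; rewrite /A /=.
    have a0 : a (- t) <= 0.
      rewrite /a -oppr_ge0 -!mulNr opprK.
      by rewrite divr_ge0 ?dot_ge0 // divr_ge0 // mulr_ge0 // divr_ge0 //; lra.
    by rewrite ler_wnM2l //; lra.
  have a0 : 0 <= a t by rewrite /a divr_ge0 ?dot_ge0 // divr_ge0 // mulr_ge0 // divr_ge0 //; lra.
  by rewrite ler_wpM2l //; lra.
apply: le_trans (measureU2 _ (mA _) (mA _)) _.
rewrite mulr_natl mulr2n EFinD; apply: leeD; apply: PA => //; rewrite ?sqrrN //.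
  by apply/andP; split; lra.
by apply/andP; split; lra.
Qed.

End Chernoff.

(** * Reduction to a net *)

Section Net.
Variables (R : realType) (M N : nat) (Phi : 'M[R]_(M, N)).

Let Q := @deviation R M N Phi.

(* The parallelogram identity for the pair [x, y - x] bounds the best constant
   [c] by [(16 t + 38 c) / 50]. *)
Lemma deviation_net (t : R) (S : {set 'I_N}) : 0 <= t ->
  (forall x : 'cV[R]_N, (forall i, i \notin S -> x i ord0 = 0) -> dot x x = 1 ->
    exists y : 'cV[R]_N, [/\ forall i, i \notin S -> y i ord0 = 0,
      dot (y - x) (y - x) <= 1/25 & `|Q y| <= t * dot y y]) ->
  forall x : 'cV[R]_N, (forall i, i \notin S -> x i ord0 = 0) -> `|Q x| <= 4/3 * t * dot x x.
Proof.
move=> t0 net.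
pose supp (x : 'cV[R]_N) := forall i, i \notin S -> x i ord0 = 0.
pose E := [set r | exists x, [/\ supp x, dot x x = 1 & r = `|Q x|]].
(* The best constant on the vectors supported on S, finite by [deviation_bounded] and extended from
   unit vectors by homogeneity. *)
pose c := sup E.
have [B QB] := deviation_bounded Phi.
have Eub : has_ubound E.
  by exists B => r [x [_ x1 ->]]; have := QB x; rewrite x1 mulr1.
have Qc x : supp x -> `|Q x| <= c * dot x x.
  move=> sx; have [->|x0] := eqVneq x 0.
    by rewrite /Q /deviation mulmx0 !dot0l mulr0 subrr normr0.
  have n0 : 0 < dot x x by rewrite lt_neqAle eq_sym dot_eq0 x0 dot_ge0.
  pose a := (Num.sqrt (dot x x))^-1.
  have a2 : a ^+ 2 = (dot x x)^-1 by rewrite exprVn sqr_sqrtr ?ltW.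
  have : E `|Q (a *: x)|.
    exists (a *: x); split => //; first by move=> i iS; rewrite mxE sx // mulr0.
    by rewrite dotZl dotZr mulrA -expr2 a2 mulVf // gt_eqF.
  move/(ub_le_sup Eub); rewrite -/c /Q deviationZ normrM a2 ger0_norm ?invr_ge0 ?dot_ge0 //.
  by rewrite mulrC ler_pdivrMr.
have step x : supp x -> dot x x = 1 -> t <= c -> 50 * `|Q x| <= 16 * t + 38 * c.
  move=> sx x1 tc; have [y [sy yx Qy]] := net x sx x1.
  have [e yE] : exists e, y = x + e by exists (y - x); rewrite addrC subrK.
  have eE : y - x = e by rewrite yE addrC addKr.
  rewrite eE in yx.
  have se : supp e by move=> i iS; rewrite -eE !mxE (sx i iS) (sy i iS) subrr.
  have sxe : supp (x - e) by move=> i iS; rewrite !mxE (sx i iS) (se i iS) subr0.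
  have p := deviation_parallelogram Phi x e; rewrite -/Q in p.
  have Qe := Qc e se; have Qxe := Qc _ sxe.
  have dxe : dot (x - e) (x - e) = 2 + 2 * dot e e - dot y y.
    by rewrite yE !(dotDl, dotDr, dotNl, dotNr) x1 (dotC e x); ring.
  have xe2 : dot x e ^+ 2 <= dot e e by have := dot_sqr_le x e; rewrite x1 mul1r.
  have dyy : dot y y = 1 + 2 * dot x e + dot e e.
    by rewrite yE !(dotDl, dotDr) x1 (dotC e x); ring.
  have c0 : 0 <= c := le_trans t0 tc.
  (* Since |x| = 1 and |e| <= 1/5, the length of y is at least 4/5. *)
  have yy : 16/25 <= dot y y.
    have ee := dot_ge0 e; rewrite dyy; nra.
  have : 2 * `|Q x| <= t * dot y y + c * (2 + 2 * dot e e - dot y y) + 2 * (c * dot e e).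
    move: Qy Qe Qxe; rewrite dxe yE.
    have -> : 2 * `|Q x| = `|Q (x + e) + Q (x - e) - 2 * Q e|.
      by rewrite p addrK normrM ger0_norm.
    move=> h1 h2 h3; apply: le_trans (ler_normB _ _) _; apply: lerD.
      by apply: le_trans (ler_normD _ _) _; apply: lerD.
    by rewrite normrM ger0_norm // ler_pM2l.
  have h1 : c * dot e e <= c * (1/25) by rewrite ler_wpM2l.
  (* The length of y enters the bound with coefficient t - c, so with t <= c its lower bound is what
     matters. *)
  have h2 : (c - t) * (16/25) <= (c - t) * dot y y by rewrite ler_wpM2l // subr_ge0.
  lra.
move=> x sx; apply: le_trans (Qc x sx) _; rewrite ler_wpM2r ?dot_ge0 //.
rewrite leNgt; apply/negP => ct.
have tc : t <= c by lra.
(* Without unit vectors supported on S the supremum takes its default value 0. *)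
have [E0|E0] := eqVneq E set0; first by move: ct; rewrite /c E0 sup0; lra.
have : c <= (16 * t + 38 * c) / 50.
  apply: ge_sup; first exact/set0P.
  by move=> r [u [su u1 ->]]; rewrite ler_pdivlMr // mulrC step.
lra.
Qed.

End Net.

(* A digit codes an integer of absolute value at most [B]: [None] is zero and
   [Some (n, b)] is the integer [(-1) ^ b * (n + 1)]. *)
Definition digit (B : nat) : finType := option ('I_B * bool).

Definition digit_abs B (o : digit B) : nat :=
  if o is Some (n, _) then n.+1 else 0.

Definition digit_val (R : realType) B (o : digit B) : R :=
  if o is Some (_, b) then (-1) ^+ b * (digit_abs o)%:R else 0.

Definition grid_vec (R : realType) N B (f : {ffun 'I_N -> digit B}) : 'cV[R]_N :=
  \col_i digit_val R (f i).

(** The digit bound [B] makes the set of codes finite; it will be 3K, the largest absolute value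
    compatible with an l1 norm of at most 3K. *)
Definition grid N B K : {set {ffun 'I_N -> digit B}} :=
  [set f : {ffun 'I_N -> digit B} | (\sum_i isSome (f i) <= K)%N &&
     (\sum_i digit_abs (f i) <= 3 * K)%N]%SET.

(** * Rounding sparse vectors to integer vectors *)

Section GridApproximation.
Variables (R : realType) (N K : nat).

Lemma sum_sqr_le_card (S : {set 'I_N}) (m : 'I_N -> R) :
  (\sum_(i in S) m i) ^+ 2 <= #|S|%:R * \sum_(i in S) m i ^+ 2.
Proof.
pose u : 'cV[R]_N := \col_i (i \in S)%:R.
pose v : 'cV[R]_N := \col_i ((i \in S)%:R * m i).
have := dot_sqr_le u v.
have -> : dot u v = \sum_(i in S) m i.
  rewrite [RHS]big_mkcond; apply: eq_bigr => i _; rewrite !mxE.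
  by case: ifP; rewrite ?mul1r ?mul0r.
have -> : dot u u = #|S|%:R.
  rewrite -sum1_card natr_sum [RHS]big_mkcond; apply: eq_bigr => i _; rewrite !mxE.
  by case: ifP; rewrite ?mul1r ?mul0r.
have -> // : dot v v = \sum_(i in S) m i ^+ 2.
rewrite [RHS]big_mkcond; apply: eq_bigr => i _; rewrite !mxE.
by case: ifP; rewrite ?mul1r ?mul0r ?expr2.
Qed.

Lemma grid_approx (S : {set 'I_N}) (x : 'cV[R]_N) : (0 < K)%N -> (#|S| <= K)%N ->
  (forall i, i \notin S -> x i ord0 = 0) -> dot x x = 1 ->
  exists (f : {ffun 'I_N -> digit (3 * K)}) (a : R),
    [/\ f \in grid N (3 * K) K, forall i, i \notin S -> grid_vec R f i ord0 = 0 &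
      dot (a *: grid_vec R f - x) (a *: grid_vec R f - x) <= 1/25].
Proof.
move=> K0 SK sx x1.
(* At most K coordinates are rounded, each with error at most 1/2; after division by c the total
   squared error is at most K (1/4) / c^2 = 1/25. *)
pose c : R := 5/2 * Num.sqrt K%:R.
have k0 : 0 < K%:R :> R by rewrite ltr0n.
have c0 : 0 < c by rewrite mulr_gt0 ?sqrtr_gt0 //; lra.
have c2 : c ^+ 2 = 25/4 * K%:R by rewrite exprMn sqr_sqrtr ?ltW //; field.
pose m i := Num.truncn (c * `|x i ord0| + 1/2).
have mE i : `|(m i)%:R - c * `|x i ord0| | <= 1/2.
  have : 0 <= c * `|x i ord0| by rewrite mulr_ge0 // ltW.
  rewrite /m; move: (c * _) => z z0.
  have : 0 <= z + 1/2 by lra.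
  move=> /truncn_itv; move: (Num.truncn _) => n; rewrite -[n.+1%:R]natr1 => /andP[h1 h2].
  by rewrite ler_norml; apply/andP; split; lra.
(* A natural number at distance at most 1/2 from 0 is 0, so rounding keeps the support. *)
have m0 i : i \notin S -> m i = 0%N.
  move=> iS; have := mE i; rewrite sx // normr0 mulr0 subr0 normr_nat => h.
  by apply/eqP; rewrite -leqn0 -ltnS -(ltr_nat R) (le_lt_trans h) //; lra.
pose v : 'cV[R]_N := \col_i ((-1) ^+ (x i ord0 < 0)%R * (m i)%:R).
pose e := c^-1 *: v - x.
have ei i : e i ord0 ^+ 2 = ((m i)%:R - c * `|x i ord0|) ^+ 2 / c ^+ 2.
  rewrite /e !mxE {2}(realEsign (num_real (x i ord0))).
  set sg := (-1) ^+ _; have sg2 : sg ^+ 2 = 1 by rewrite sqrr_sign.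
  transitivity (sg ^+ 2 * (((m i)%:R - c * `|x i ord0|) ^+ 2 / c ^+ 2)); last by rewrite sg2 mul1r.
  by field; rewrite gt_eqF.
have ee : dot e e <= 1/25.
  have -> : dot e e = \sum_(i in S) e i ord0 ^+ 2.
    rewrite [RHS]big_mkcond; apply: eq_bigr => i _; case: ifPn => iS; first by rewrite expr2.
    by rewrite -expr2 ei m0 // sx // normr0 mulr0 subrr expr0n mul0r.
  apply: (@le_trans _ _ (\sum_(i in S) (1/4 / c ^+ 2))).
    apply: ler_sum => i _; rewrite ei ler_pM2r ?invr_gt0 ?exprn_gt0 //.
    by rewrite -real_normK ?num_real //; have := mE i; have := normr_ge0 ((m i)%:R - c * `|x i ord0|); nra.
  rewrite sumr_const -[_ *+ #|S|]mulr_natl c2.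
  apply: (@le_trans _ _ (K%:R * (1/4 / (25/4 * K%:R)))).
    by rewrite ler_wpM2r ?ler_nat // !divr_ge0 ?mulr_ge0 //; lra.
  by rewrite le_eqVlt; apply/orP; left; apply/eqP; field; rewrite gt_eqF.
have close := ee; rewrite /e in close.
have vE : v = c *: (x + e) by rewrite /e addrC subrK scalerA mulfV ?gt_eqF // scale1r.
clearbody e.
(* |v| = c |x + e| <= (5/2) sqrt(K) (6/5) = 3 sqrt(K); Cauchy-Schwarz on S then gives the l1 norm
   3K. *)
have vv : dot v v <= 9 * K%:R.
  rewrite vE dotZl dotZr mulrA -expr2 c2 !(dotDl, dotDr) x1 (dotC e x).
  have xe2 : dot x e ^+ 2 <= dot e e by have := dot_sqr_le x e; rewrite x1 mul1r.
  have xe : dot x e <= 1/5 by have := dot_ge0 e; nra.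
  by nra.
have l1 : (\sum_i m i <= 3 * K)%N.
  have -> : (\sum_i m i = \sum_(i in S) m i)%N.
    by rewrite [RHS]big_mkcond; apply: eq_bigr => i _; case: ifPn => // /m0.
  rewrite -(ler_nat R) natr_sum natrM.
  rewrite -(@ler_pXn2r _ 2) ?nnegrE ?mulr_ge0 ?sumr_ge0 //.
  apply: le_trans (sum_sqr_le_card _ _) _.
  have -> : \sum_(i in S) (m i)%:R ^+ 2 = dot v v.
    rewrite [LHS]big_mkcond; apply: eq_bigr => i _; rewrite mxE -expr2 exprMn sqrr_sign mul1r.
    by case: ifPn => // /m0 ->; rewrite expr0n.
  apply: (@le_trans _ _ (K%:R * (9 * K%:R))).
    by rewrite ler_pM ?dot_ge0 ?ler_nat.
  by rewrite le_eqVlt; apply/orP; left; apply/eqP; ring.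
have mB i : (m i <= 3 * K)%N by apply: leq_trans l1; rewrite (bigD1 i) //= leq_addr.
(* A nonzero magnitude m'+1 is stored as the index m', which is below 3K by [mB]. *)
pose f : {ffun 'I_N -> digit (3 * K)} := [ffun i =>
  if m i is m'.+1 then omap (fun n => (n, x i ord0 < 0)) (insub m') else None].
have fE i : (isSome (f i) = (m i != 0%N)) * (digit_abs (f i) = m i) *
    (digit_val R (f i) = v i ord0).
  rewrite ffunE mxE; have := mB i; case: (m i) => [|m'] mB'.
    by rewrite /= mulr0.
  by rewrite insubT.
have fv : grid_vec R f = v by apply/colP => i; rewrite mxE fE.
exists f, c^-1; split; last by rewrite fv.
  rewrite inE; apply/andP; split.
    apply: leq_trans SK; rewrite -sum1_card [leqRHS]big_mkcond /=.
    apply: leq_sum => i _; rewrite fE; case: ifPn => [_|/m0 -> //].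
    by case: (_ != _).
  by apply: leq_trans l1; apply: leq_sum => i _; rewrite fE.
by move=> i iS; rewrite fv mxE m0 // mulr0.
Qed.

End GridApproximation.

(** * Counting the integer vectors *)

Section GridCount.
Variables (R : realType) (N K : nat).

Lemma sum_half_le1 B : \sum_(n < B) (1/2 : R) ^+ n.+1 <= 1.
Proof.
suff -> : \sum_(n < B) (1/2 : R) ^+ n.+1 = 1 - (1/2) ^+ B.
  by rewrite gerBl exprn_ge0 //; lra.
elim: B => [|B IH]; first by rewrite big_ord0 expr0 subrr.
by rewrite big_ord_recr /= IH exprS; field.
Qed.

(** exp(9/4) >= (1 + 3/20)^15, and (1 + 3/20)^5 >= 2. *)
Lemma eight_le_expR : 8 <= expR (9/4) :> R.
Proof.
have -> : 9/4 = 15%:R * (3/20) :> R by field.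
rewrite expRM_natl; apply: (@le_trans _ _ ((1 + 3/20) ^+ 15)).
  have h : (2 : R) <= (1 + 3/20) ^+ 5 by lra.
  have -> : (1 + 3/20 : R) ^+ 15 = ((1 + 3/20) ^+ 5) ^+ 3 by rewrite -exprM.
  have -> : (8 : R) = 2 ^+ 3 by ring.
  by apply: lerXn2r => //; rewrite nnegrE; lra.
by rewrite lerXn2r ?nnegrE ?expR_ge0 ?expR_ge1Dx //; lra.
Qed.

(* Chernoff-type counting: give each nonzero digit [k] the weight
   [(K / N) * 2 ^ (- |k|)], so that every grid point has weight at least
   [(K / N) ^ K * 8 ^ (- K)] while the total weight is at most [(1 + 2 K / N) ^ N]. *)
Lemma grid_count B : (0 < K <= N)%N ->
  #|grid N B K|%:R <= expR (K%:R * ln (expR 1 * N%:R / K%:R) + 13/4 * K%:R) :> R.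
Proof.
move=> /andP[K0 KN].
have k0 : 0 < K%:R :> R by rewrite ltr0n.
have n0 : 0 < N%:R :> R by rewrite ltr0n (leq_trans K0).
pose s : R := K%:R / N%:R.
have s0 : 0 < s by rewrite divr_gt0.
have s1 : s <= 1 by rewrite ler_pdivrMr // mul1r ler_nat.
pose w (o : digit B) : R := s ^+ isSome o * (1/2) ^+ digit_abs o.
have w0 o : 0 <= w o by rewrite mulr_ge0 // exprn_ge0 // ?ltW //; lra.
(* By distributivity this is the N-th power of the total weight of one digit, which is at most 1 + 2
   s: two signs times a geometric sum. *)
have total : \sum_(f : {ffun 'I_N -> digit B}) \prod_i w (f i) <= expR (2 * K%:R).
  rewrite -(bigA_distr_bigA (fun _ : 'I_N => w)) /= prodr_const card_ord.
  apply: (@le_trans _ _ ((1 + 2 * s) ^+ N)).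
    have W0 : 0 <= \sum_o w o by apply: sumr_ge0.
    rewrite lerXn2r ?nnegrE //; first by lra.
    rewrite (bigD1 None) //= {1}/w /= !expr0 mulr1 lerD2l.
    rewrite (reindex_omap Some id) /=; last by case.
    rewrite (eq_bigl xpredT) => [|i]; last by rewrite eqxx.
    rewrite (eq_bigr (fun p : 'I_B * bool => s * (1/2) ^+ p.1.+1)) => [|[n b] _ //].
    rewrite -(pair_bigA _ (fun (n : 'I_B) (_ : bool) => s * (1/2) ^+ n.+1)) /=.
    under eq_bigr do rewrite sumr_const card_bool.
    rewrite sumrMnl -mulr_sumr -[X in _ <= X * _]/(2%:R) mulr_natl lerMn2r /=.
    by rewrite ler_piMr ?sum_half_le1 // ltW.
  have -> : 2 * K%:R = N%:R * (2 * s) by rewrite /s; field; rewrite gt_eqF.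
  by rewrite expRM_natl lerXn2r ?nnegrE ?expR_ge0 ?expR_ge1Dx //; lra.
have lower f : f \in grid N B K -> s ^+ K * (1/2) ^+ (3 * K) <= \prod_i w (f i).
  rewrite inE => /andP[h1 h2]; rewrite big_split /= !prodrXr.
  have half0 : 0 <= 1/2 :> R by lra.
  have half1 : 1/2 <= 1 :> R by lra.
  by rewrite ler_pM ?exprn_ge0 ?(ltW s0) // ler_wiXn2l // ltW.
have L : s ^+ K * (1/2) ^+ (3 * K) * #|grid N B K|%:R <= expR (2 * K%:R).
  apply: le_trans total; rewrite mulr_natr -sumr_const.
  rewrite [leRHS](bigID (mem (grid N B K))) /= -[leLHS]addr0 lerD //.
    by apply: ler_sum => f; exact: lower.
  by apply: sumr_ge0 => f _; apply: prodr_ge0 => i _.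
have sE : s ^+ K = expR (K%:R - K%:R * ln (expR 1 * N%:R / K%:R)).
  have -> : K%:R - K%:R * ln (expR 1 * N%:R / K%:R) = K%:R * ln s.
    rewrite -{1}[K%:R]mulr1 -mulrBr; congr (_ * _).
    rewrite -mulrA lnM ?posrE ?expR_gt0 ?divr_gt0 // expRK opprD addNKr.
    by rewrite -lnV ?posrE ?divr_gt0 // invf_div.
  by rewrite expRM_natl lnK.
have hE : expR (- (9/4 * K%:R)) <= (1/2) ^+ (3 * K) :> R.
  rewrite mulrC expRN expRM_natl exprM -exprVn.
  have -> : (1/2 : R) ^+ 3 = 8^-1 by field.
  rewrite lerXn2r ?nnegrE ?invr_ge0 ?expR_ge0 //.
  by rewrite lef_pV2 ?posrE ?expR_gt0 ?eight_le_expR.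
have pos : (0 : R) < expR (K%:R - K%:R * ln (expR 1 * N%:R / K%:R)) * expR (- (9/4 * K%:R)).
  by rewrite mulr_gt0 ?expR_gt0.
rewrite -(ler_pM2l pos) -!expRD.
set X := (X in expR X * _ <= _); set Y := (Y in _ <= expR Y).
(* The constant 13/4 is 2 - 1 + 9/4: the total weight, the factor e in the logarithm, and the bound
   on 8^K. *)
have -> : Y = 2 * K%:R by rewrite /Y /X; field.
by apply: le_trans L; rewrite ler_wpM2r // sE /X expRD ler_wpM2l ?expR_ge0.
Qed.

End GridCount.

(** * Measurability of the events *)

Section SampleEvents.
Context (R : realType) (d : measure_display) (Omega : measurableType d).
Variables (P : probability Omega R) (M N : nat).
Variable X : 'I_M * 'I_N -> {RV P >-> R}.

Lemma measurable_mx_exp n (G : Omega -> 'M[R]_n) :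
  (forall i j, measurable_fun [set: Omega] (fun w => G w i j)) ->
  forall k i j, measurable_fun [set: Omega] (fun w => (G w ^+ k) i j).
Proof.
move=> mG; elim=> [|k IH] i j; first exact: measurable_cst.
rewrite (funext (fun w => congr1 (fun A : 'M[R]_n => A i j) (exprS (G w) k))).
under eq_fun do rewrite -mulmxE mxE.
by apply: measurable_sum => l; apply: measurable_funM.
Qed.

Lemma measurable_power_delta_event (K q : nat) (c : R) : 0 <= c ->
  measurable [set w | power_delta (sample_matrix X w) K q <= c].
Proof.
move=> c0; pose I := [set S : {set 'I_N} | #|S| == K]%SET.
pose A (S : {set 'I_N}) := [set w |
  \tr (gram_deviation (sample_matrix X w) S ^+ (2 * q)) `^ ((2 * q)%:R^-1) <= c].
rewrite (_ : [set w | _] = \bigcap_(S in [set` I]) A S).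
  apply: fin_bigcap_measurable => // S _; apply: measurable_set_ler => //.
  apply: (measurableT_comp (measurable_powR _)).
  apply: measurable_sum => i; apply: measurable_mx_exp => i1 i2.
  rewrite /gram_deviation.
  under eq_fun do rewrite !mxE.
  apply: measurable_funD => //; apply: measurable_sum => l.
  under eq_fun do rewrite !mxE.
  by apply: measurable_funM.
apply/seteqP; split => w /=.
  by move=> /bigmax_leP[_ h] S /=; rewrite inE; exact: h.
by move=> h; apply/bigmax_leP; split => // S SK; apply: h; rewrite /= inE.
Qed.

(** Zero coordinates stay zero, so sparsity survives; an error eta / (N+1) per coordinate
    suffices. *)
Lemma rational_approx (x : 'cV[R]_N) (eta : R) : 0 < eta ->
  exists r : 'cV[rat]_N, (forall i, x i ord0 = 0 -> r i ord0 = 0) /\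
    dot (map_mx ratr r - x) (map_mx ratr r - x) <= eta ^+ 2.
Proof.
move=> e0; pose z := eta / N.+1%:R; have z0 : 0 < z by rewrite divr_gt0.
have /choice[r hr] : forall i, exists r : rat,
    (x i ord0 = 0 -> r = 0) /\ `|ratr r - x i ord0| <= z.
  move=> i; have [->|xi] := eqVneq (x i ord0) 0.
    by exists 0; rewrite raddf0 subrr normr0 ltW.
  have [|r] := @rat_in_itvoo R (x i ord0) (x i ord0 + z); first by rewrite ltrDl.
  rewrite in_itv /= => /andP[h1 h2]; exists r; split; first by move=> h; rewrite h eqxx in xi.
  by rewrite ler_norml; apply/andP; split; lra.
exists (\col_i r i); split; first by move=> i xi; rewrite mxE; exact: (hr i).1.
apply: (@le_trans _ _ (\sum_(i < N) z ^+ 2)).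
  apply: ler_sum => i _; rewrite !mxE -expr2 -real_normK ?num_real //.
  by rewrite lerXn2r ?nnegrE ?normr_ge0 ?(ltW z0) ?(hr i).2.
rewrite sumr_const card_ord -[_ *+ N]mulr_natl /z exprMn exprVn mulrCA ler_piMr ?sqr_ge0 //.
rewrite ler_pdivrMr ?exprn_gt0 // mul1r -natrX ler_nat.
by rewrite (leq_trans (leqnSn N)) // leq_pmull.
Qed.

(* Restricting to rational vectors makes the event a countable intersection. *)
Lemma RIP_rational (Phi : 'M[R]_(M, N)) (K : nat) (c : R) :
  (forall r : 'cV[rat]_N, sparse K (map_mx ratr r : 'cV[R]_N) ->
     `|deviation Phi (map_mx ratr r)| <= c * dot (map_mx ratr r) (map_mx ratr r)) ->
  RIP Phi K c.
Proof.
move=> h; apply/RIPE => x sx.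
have [B QB] := deviation_bounded Phi.
(* Half the gradient of [deviation] at x, so that the expansion at x + e is exact. *)
pose u := Phi^T *m (Phi *m x) - x.
have QE e : deviation Phi (x + e) = deviation Phi x + 2 * dot e u + deviation Phi e.
  rewrite /deviation /u !mulmxDr !(dotDl, dotDr, dotNr).
  rewrite -dot_mulmx (dotC (Phi *m x) (Phi *m e)) (dotC x e); ring.
pose C := 2 * Num.sqrt (dot u u) + `|B| + `|c| * (2 * Num.sqrt (dot x x) + 1).
have key eta : 0 < eta <= 1 -> `|deviation Phi x| <= c * dot x x + C * eta.
  move=> /andP[e0 e1]; have [r [r0 rx]] := rational_approx x e0.
  have : sparse K (map_mx ratr r : 'cV[R]_N).
    apply: leq_trans sx; apply: subset_leq_card; apply/fintype.subsetP => i.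
    by rewrite !inE mxE; apply: contraNneq => /r0 ->; rewrite raddf0.
  move=> /h; set y : 'cV[R]_N := map_mx ratr r in rx *.
  have yE : y = x + (y - x) by rewrite addrC subrK.
  move: (y - x) rx yE => e ee ->.
  have dot_le v : `|dot e v| <= Num.sqrt (dot v v) * eta.
    rewrite -(@ler_pXn2r _ 2) ?nnegrE ?mulr_ge0 ?sqrtr_ge0 ?(ltW e0) //.
    rewrite real_normK ?num_real // exprMn sqr_sqrtr ?dot_ge0 //.
    by apply: le_trans (dot_sqr_le _ _) _; rewrite mulrC ler_wpM2l ?dot_ge0.
  have eta2 : eta ^+ 2 <= eta by rewrite expr2 ler_piMr // ltW.
  have ee1 : dot e e <= eta by lra.
  have Qe : `|deviation Phi e| <= `|B| * eta.
    apply: le_trans (QB e) _; apply: (@le_trans _ _ (`|B| * dot e e)).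
      by rewrite ler_wpM2r ?dot_ge0 // ler_norm.
    by rewrite ler_wpM2l.
  have le1 : `|2 * dot e u| <= 2 * Num.sqrt (dot u u) * eta.
    by rewrite normrM ger0_norm // -mulrA ler_pM2l.
  have le2 : c * (dot (x + e) (x + e) - dot x x) <= `|c| * (2 * Num.sqrt (dot x x) + 1) * eta.
    apply: le_trans (ler_norm _) _; rewrite normrM -mulrA ler_wpM2l //.
    have -> : dot (x + e) (x + e) - dot x x = 2 * dot e x + dot e e.
      by rewrite !(dotDl, dotDr) (dotC x e); ring.
    apply: le_trans (ler_normD _ _) _; rewrite normrM ger0_norm // [leRHS]mulrDl mul1r.
    by rewrite lerD // ?(ger0_norm (dot_ge0 e)) // -mulrA ler_pM2l.
  rewrite QE => h1.
  have : `|deviation Phi x| <= `|deviation Phi x + 2 * dot e u + deviation Phi e|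
      + (`|2 * dot e u| + `|deviation Phi e|).
    apply: le_trans (lerD (lexx _) (ler_normD _ _)).
    by rewrite -[X in `|X| <= _](addrK (2 * dot e u + deviation Phi e)) addrA ler_normB.
  rewrite /C; lra.
have C0 : 0 <= C by rewrite /C !addr_ge0 // mulr_ge0 ?addr_ge0 ?mulr_ge0 ?sqrtr_ge0.
rewrite leNgt; apply/negP => hlt.
pose D := `|deviation Phi x| - c * dot x x; have D0 : 0 < D by rewrite subr_gt0.
(* This choice makes C eta < D, contradicting [key]. *)
pose eta := D / (C + D).
have CD : 0 < C + D by rewrite ltr_wpDl.
have := key eta; rewrite /eta divr_gt0 //= ler_pdivrMr // mul1r lerDr C0 => /(_ isT).
rewrite leNgt => /negP; apply.
rewrite -ltrBrDl -/D mulrA ltr_pdivrMr // mulrC ltr_pM2l //.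
by rewrite ltrDl.
Qed.

Lemma measurable_RIP_event (K : nat) (c : R) :
  measurable [set w | RIP (sample_matrix X w) K c].
Proof.
pose A (r : 'cV[rat]_N) := [set w |
  sparse K (map_mx ratr r : 'cV[R]_N) ->
  `|deviation (sample_matrix X w) (map_mx ratr r)|
    <= c * dot (map_mx ratr r) (map_mx ratr r)].
have mA r : measurable (A r).
  rewrite /A; case: (sparse _ _); last by rewrite (_ : [set w | _] = setT) //; apply/seteqP; split.
  rewrite (_ : [set w | _] = [set w | `|deviation (sample_matrix X w) (map_mx ratr r)|
    <= c * dot (map_mx ratr r) (map_mx ratr r)]); last first.
    by apply/seteqP; split => w /=; [exact|].
  apply: measurable_set_ler => //; apply: measurableT_comp => //.
  exact: measurable_deviation.
(* Rational vectors are enumerated by their codes; an index that codes none contributes the whole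
   space. *)
rewrite (_ : [set w | _] = \bigcap_n (if unpickle n is Some r then A r else setT)).
  by apply: bigcapT_measurable => n; case: unpickle.
apply/seteqP; split => w /=.
  by move=> /RIPE h n _; case: unpickle => // r sr; exact: h.
move=> h; apply: RIP_rational => r; have := h (pickle r) I.
by rewrite pickleK.
Qed.

Lemma probability_bigsetU_le (I : Type) (s : seq I) (A : I -> set Omega) :
  (forall i, measurable (A i)) ->
  (P (\big[setU/set0]_(i <- s) A i) <= \sum_(i <- s) P (A i))%E.
Proof.
move=> mA; elim: s => [|i s IH]; first by rewrite !big_nil measure0.
rewrite !big_cons; apply: le_trans (measureU2 _ _ _) _ => //.
  exact: bigsetU_measurable.
exact: leeD.
Qed.

End SampleEvents.

(** * Conclusion *)

(** The net argument is applied on the support of x; multiples of grid vectors serve as net because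
    both sides are homogeneous of degree 2. *)
Lemma deviation_grid (R : realType) (M N K : nat) (Phi : 'M[R]_(M, N)) (t : R) :
  (0 < K)%N -> 0 <= t ->
  (forall f, f \in grid N (3 * K) K ->
    `|deviation Phi (grid_vec R f)| <= t * dot (grid_vec R f) (grid_vec R f)) ->
  forall x, sparse K x -> `|deviation Phi x| <= 4/3 * t * dot x x.
Proof.
move=> K0 t0 h x sx; pose S := [set i | x i ord0 != 0]%SET.
have SK : (#|S| <= K)%N by apply: leq_trans sx; rewrite cardsE.
apply: (deviation_net (S := S)) => //; last first.
  by move=> i; rewrite inE negbK => /eqP.
move=> z zS z1; have [f [a [fg fS fz]]] := grid_approx K0 SK zS z1.
exists (a *: grid_vec R f); split => //.
  by move=> i iS; rewrite mxE fS // mulr0.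
rewrite deviationZ normrM ger0_norm ?sqr_ge0 // dotZl dotZr.
rewrite [leRHS](_ : _ = a ^+ 2 * (t * dot (grid_vec R f) (grid_vec R f))); last by ring.
by rewrite ler_wpM2l ?sqr_ge0 // h.
Qed.

(** L = K (1 + log(N/K)), while log N = log K + log(N/K) and log K <= K - 1. *)
Lemma entropy_bounds (R : realType) (N K : nat) : (0 < K <= N)%N ->
  let L : R := K%:R * ln (expR 1 * N%:R / K%:R) in K%:R <= L /\ ln N%:R <= L.
Proof.
move=> /andP[K0 KN] L.
have k0 : 0 < K%:R :> R by rewrite ltr0n.
have k1 : 1 <= K%:R :> R by rewrite ler1n.
have n0 : 0 < N%:R :> R by rewrite ltr0n (leq_trans K0).
have r1 : 1 <= N%:R / K%:R :> R by rewrite ler_pdivlMr // mul1r ler_nat.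
have LE : L = K%:R * (1 + ln (N%:R / K%:R)).
  by rewrite /L -mulrA lnM ?posrE ?expR_gt0 ?divr_gt0 // expRK.
have l0 := ln_ge0 r1.
have lN : ln N%:R = ln K%:R + ln (N%:R / K%:R) :> R.
  by rewrite -lnM ?posrE ?divr_gt0 // mulrCA mulfV ?mulr1 // gt_eqF.
have lK : ln (1 + (K%:R - 1)) <= K%:R - 1 :> R by apply: le_ln1Dx; lra.
rewrite addrC subrK in lK.
by rewrite LE lN; split; nra.
Qed.

Section HighProbability.
Context (R : realType) (d : measure_display) (Omega : measurableType d).
Variables (P : probability Omega R) (M N K q : nat) (delta : R).
Variable X : 'I_M * 'I_N -> {RV P >-> R}.
Hypotheses (q_gt0 : (0 < q)%N) (KN : (0 < K <= N)%N) (delta01 : 0 < delta < 1).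
Hypothesis M_large :
  81 / delta ^+ 2 * K%:R `^ (1 + q%:R^-1) * ln (expR 1 * N%:R / K%:R) <= M%:R.
Hypothesis X_iid : iid_gaussian_entries X.

Let L : R := K%:R * ln (expR 1 * N%:R / K%:R).
(** The power of K offsets the loss from form to trace, and the factor 3/4 in [t] offsets the 4/3 of
    the net. *)
Let delta' : R := delta * K%:R `^ (- (2 * q)%:R^-1).
Let t : R := 3/4 * delta'.

Let k1 : 1 <= K%:R :> R.
Proof. by rewrite ler1n; case/andP: KN. Qed.

Let delta'_bounds : 0 < delta' <= 1.
Proof.
have /andP[d0 d1] := delta01.
have k0 := lt_le_trans ltr01 k1.
apply/andP; split; first by rewrite mulr_gt0 ?powR_gt0.
apply: mulr_ile1; rewrite ?powR_ge0 ?(ltW d0) ?(ltW d1) //.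
by rewrite powRN invf_le1 ?powR_gt0 // -[leLHS](powRr0 K%:R) ler_powR ?invr_ge0.
Qed.

Let M_delta' : 81 * L <= M%:R * delta' ^+ 2.
Proof.
have /andP[d0 d1] := delta01.
have k0 := lt_le_trans ltr01 k1.
have kq : 0 < K%:R `^ q%:R^-1 :> R by rewrite powR_gt0.
have -> : delta' ^+ 2 = delta ^+ 2 / K%:R `^ q%:R^-1.
  rewrite exprMn -(powR_mulrn 2 (powR_ge0 _ _)) -powRrM -powRN; congr (_ * _ `^ _).
  by rewrite natrM; field; rewrite pnatr_eq0 -lt0n.
rewrite mulrA ler_pdivlMr // -ler_pdivrMr ?exprn_gt0 //.
have kE : K%:R `^ (1 + q%:R^-1) = K%:R * K%:R `^ q%:R^-1 :> R.
  by rewrite powRD ?powRr1 ?(ltW k0) // (gt_eqF k0) implybT.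
apply: le_trans M_large; rewrite kE /L.
by rewrite le_eqVlt; apply/orP; left; apply/eqP; field; rewrite gt_eqF.
Qed.

Let M_gt0 : (0 < M)%N.
Proof.
have [KL _] := @entropy_bounds R N K KN.
rewrite -(ltr_nat R); have := M_delta'; rewrite ltNge => h; apply/negP => m0.
have := mulr_le0_ge0 m0 (sqr_ge0 delta').
by move: h KL; rewrite -/L => h KL h'; have := k1; lra.
Qed.

Let bad (f : {ffun 'I_N -> digit (3 * K)}) := [set w | t * dot (grid_vec R f) (grid_vec R f) <
  `|deviation (sample_matrix X w) (grid_vec R f)|].

Let measurable_bad f : measurable (bad f).
Proof.
apply: measurable_set_ltr => //; apply: measurableT_comp => //.
exact: measurable_deviation.
Qed.

Lemma power_delta_high_probability :
  ((1 - 2 * expR (- (ln N%:R / 4)))%:E <=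
   P [set w | (power_delta (sample_matrix X w) K q <= delta)%R])%E.
Proof.
have /andP[d0 d1] := delta01.
have /andP[d'0 d'1] := delta'_bounds.
have k0 := lt_le_trans ltr01 k1.
have t0 : 0 < t by rewrite mulr_gt0 //; lra.
have t34 : t <= 3/4 by rewrite /t; lra.
pose U := \big[setU/set0]_(f <- enum (grid N (3 * K) K)) bad f.
have mU : measurable U by exact: bigsetU_measurable.
have PU : (P U <= (2 * expR (- (ln N%:R / 4)))%:E)%E.
  apply: le_trans (probability_bigsetU_le P _ measurable_bad) _.
  apply: (@le_trans _ _ (\sum_(f <- enum (grid N (3 * K) K))
      (2 * expR (- (M%:R * t ^+ 2 / 10)))%:E)%E).
    apply: lee_sum => f _; apply: deviation_tail => //; exact/andP.
  rewrite sumEFin lee_fin big_enum /= sumr_const -[_ *+ #|_|]mulr_natl.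
  rewrite mulrCA ler_pM2l //.
  have gc := @grid_count R _ _ (3 * K) KN.

  apply: le_trans (ler_wpM2r (expR_ge0 _) gc) _.
  rewrite -expRD ler_expR -/L.
  have [KL NL] := @entropy_bounds R N K KN.
  (* The tail exponent is at least (729/160) L and the count costs at most (1 + 13/4) L; the
     remaining (49/160) L exceeds (log N) / 4. *)
  have -> : M%:R * t ^+ 2 / 10 = 9/160 * (M%:R * delta' ^+ 2) by rewrite /t; field.
  by move: KL NL M_delta'; rewrite -/L; lra.
apply: (@le_trans _ _ (P (~` U))).
  by rewrite probability_setC // EFinB leeB.
apply: le_measure; rewrite ?inE; first exact: measurableC.
  by apply: measurable_power_delta_event; exact: ltW.
move=> w /= Uw.
have good f : f \in grid N (3 * K) K ->
    `|deviation (sample_matrix X w) (grid_vec R f)| <= t * dot (grid_vec R f) (grid_vec R f).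
  move=> fg; rewrite leNgt; apply/negP => fbad; apply: Uw.
  by rewrite /U -bigcup_seq; exists f => //=; rewrite mem_enum.
have /andP[K0 _] := KN.
have dev := deviation_grid K0 (ltW t0) good.
have -> : delta = K%:R `^ ((2 * q)%:R^-1) * delta'.
  by rewrite /delta' mulrCA -powRD ?(gt_eqF k0) ?implybT // subrr powRr0 mulr1.
apply: power_delta_le => //; first exact: ltW.
move=> x sx; apply: le_trans (dev x sx) _.
by rewrite /t le_eqVlt; apply/orP; left; apply/eqP; field.
Qed.

End HighProbability.

(* "With high probability" means: with probability tending to 1 as N grows,
   uniformly in all the other parameters. *)
Theorem theorem17 (R : realType) (eps : R) (eps_gt0 : 0 < eps) :
  exists N0 : nat, forall (N : nat), (N0 <= N)%N ->
  forall (M K q : nat) (delta : R),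
    (1 <= q)%N -> (1 <= K <= N)%N -> 0 < delta < 1 ->
    81 / delta ^+ 2 * K%:R `^ (1 + q%:R^-1) * ln (expR 1 * N%:R / K%:R)
      <= M%:R ->
  forall (d : measure_display) (Omega : measurableType d)
    (P : probability Omega R) (Phi : 'I_M * 'I_N -> {RV P >-> R}),
    iid_gaussian_entries Phi ->
    [/\ ((1 - eps)%:E <=
           P [set w | (power_delta (sample_matrix Phi w) K q <= delta)%R])%E,
        (forall w, power_delta (sample_matrix Phi w) K q <= delta ->
           RIP (sample_matrix Phi w) K delta)
      & ((1 - eps)%:E <= P [set w | RIP (sample_matrix Phi w) K delta])%E].
Proof.
(* Chosen so that N >= exp(c) gives 2 N^(-1/4) <= eps. *)
pose c := 4 * ln (2 / eps).
exists (Num.truncn (expR c)).+1 => N N0 M K q delta q0 KN delta01 Mlarge d Omega P Phi iid.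
have RIPw w : power_delta (sample_matrix Phi w) K q <= delta ->
    RIP (sample_matrix Phi w) K delta.
  by apply: RIP_of_power_delta => //; case/andP: KN.
have high : ((1 - eps)%:E <=
    P [set w | (power_delta (sample_matrix Phi w) K q <= delta)%R])%E.
  apply: le_trans (power_delta_high_probability q0 KN delta01 Mlarge iid).
  rewrite lee_fin lerD2l lerN2 -ler_pdivlMl // [leRHS]mulrC.
  have n0 : 0 < N%:R :> R by rewrite ltr0n (leq_trans _ N0).
  have cN : c <= ln N%:R.
    rewrite -ler_expR lnK ?posrE //; apply: ltW.
    have /andP[_ h] := truncn_itv (expR_ge0 c).
    by apply: lt_le_trans h _; rewrite ler_nat.
  rewrite -[leRHS]lnK ?posrE ?divr_gt0 // ler_expR -(invf_div 2 eps) lnV ?posrE ?divr_gt0 //.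
  by move: cN; rewrite /c; lra.
split => //; apply: le_trans high _; apply: le_measure; rewrite ?inE.
- by apply: measurable_power_delta_event; case/andP: delta01 => /ltW.
- exact: measurable_RIP_event.
- by move=> w; exact: RIPw.
Qed.
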